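(* Suppose that $\mathfrak p=(p_d)_{d\ge1}$ and $\mathfrak q=(q_d)_{d\ge1}$, with $p_d,q_d\in\mathcal P_d(\mathbb R)$, are two sequences of polynomials with infinitesimal distributions $(\mu,\mu')$ and $(\nu,\nu')$, respectively. Let $(\gamma,\gamma')$ denote the infinitesimal free multiplicative convolution $(\mu,\mu')\boxtimes_B(\nu,\nu')$. If $\nu=\delta_1$, then the finite-free multiplicative convolution $\mathfrak p\boxtimes\mathfrak q=(p_d\boxtimes_d q_d)_{d\ge1}$ has infinitesimal distribution $(\gamma,\gamma')$.
   Context: $\delta_1$ is the Dirac mass at $1$. $\mathcal P_d(\mathbb R)$ is the set of monic real polynomials of degree $d$ with only real roots. For a monic real polynomial $p_d$ of degree $d$ with (complex) roots $\lambda_1,\dots,\lambda_d$ with multiplicity, $m_n(p_d)=\frac1d\sum_k\lambda_k^n$. Write $p_d(x)=\sum_{k=0}^d x^{d-k}(-1)^k\binom dk\mathsf e_k(p_d)$. The finite-free multiplicative convolution is $[p_d\boxtimes_d q_d](x)=\sum_{k=0}^d x^{d-k}(-1)^k\binom dk\,\mathsf e_k(p_d)\,\mathsf e_k(q_d)$ (real-rooted when, in addition, one of the factors has no negative roots). A sequence $\mathfrak p=(p_d)$ of monic polynomials, $\deg p_d=d$, has infinitesimal distribution $(\mu,\mu')$ if $\mu$ is a probability distribution on $\mathbb R$ with finite moments $m_n(\mu)$ of all orders, $m_n(p_d)\to m_n(\mu)$ for all $n\ge0$, the limits $m_n'(\mathfrak p)=\lim_{d\to\infty}d\,(m_n(p_d)-m_n(\mu))$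 exist for all $n\ge1$, and $\mu':\mathbb R[x]\to\mathbb R$ is the linear functional with $\mu'(1)=0$, $\mu'(x^n)=m_n'(\mathfrak p)$. Write $m_n(\mu')=\mu'(x^n)$. $NC(n)$ is the set of non-crossing partitions of $\{1,\dots,n\}$; for a sequence $(u_n)$, $u_\pi=\prod_{V\in\pi}u_{|V|}$ and $u_{\pi\setminus V}=\prod_{W\in\pi,W\ne V}u_{|W|}$. $Kr(\pi)\in NC(n)$ is the Kreweras complement of $\pi\in NC(n)$ (the partition into cycles of $\pi^{-1}(1,2,\dots,n)$, with $\pi$ viewed as the permutation whose cycles are its blocks in increasing order). Free cumulants $r_n(\mu)$ are defined recursively by $m_n(\mu)=\sum_{\pi\in NC(n)}r_\pi(\mu)$; infinitesimal free cumulants $r_n'(\mu,\mu')$ recursively by $m_n(\mu')=\sum_{\pi\in NC(n)}\sum_{V\in\pi}r'_{|V|}(\mu,\mu')\,r_{\pi\setminus V}(\mu)$. Throughout, only distributions determined by their moments are considered. For $\nu$ supported on $[0,\infty)$, $\mu\boxtimes\nu$ is the probability measure with $r_n(\mu\boxtimes\nu)=\sum_{\pi\in NC(n)}r_\pi(\mu)\,r_{Kr(\pi)}(\nu)$ for all $n\ge1$, and the infinitesimal free multiplicative convolution $(\mu,\mu')\boxtimes_B(\nu,\nu')=(\gamma,\gamma')$ is given by $\gamma=\mu\boxtimes\nu$ and $\gamma'$ the linear functional on $\mathbb R[x]$ with $\gamma'(1)=0$ and, for all $n\ge1$, $$r_n'(\gamma,\gamma')=\sum_{\pi\in NC(n)}\Bigl(\sum_{V\in\pi}r'_{|V|}(\mu,\mu')\,r_{\pi\setminus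 V}(\mu)\cdot r_{Kr(\pi)}(\nu)+\sum_{W\in Kr(\pi)}r_\pi(\mu)\cdot r'_{|W|}(\nu,\nu')\,r_{Kr(\pi)\setminus W}(\nu)\Bigr).$$ *)

(* Defs.v *)
From HB Require Import structures.
From mathcomp Require Import all_boot all_order all_algebra all_fingroup.
From mathcomp Require Import reals complex.

Set Implicit Arguments.
Unset Strict Implicit.
Unset Printing Implicit Defensive.

Import Order.TTheory GRing.Theory Num.Theory.

Local Open Scope ring_scope.

Section Polynomials.
Variable R : realType.
Implicit Types (p q : {poly R}) (d n k : nat).

Definition complexify p : {poly R[i]} := map_poly (real_complex R) p.

Definition complex_roots p : seq R[i] :=
  sval (closed_field_poly_normal (complexify p)).

Definition monic_of_degree d p := p \is monic /\ size p = d.+1.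

Definition real_rooted d p :=
  monic_of_degree d p /\
  forall z : R[i], root (complexify p) z -> z \is Num.real.

Definition complex_moment p n : R[i] :=
  (size p).-1%:R^-1 * \sum_(z <- complex_roots p) z ^+ n.

(* No information is lost by taking the real part: see [poly_momentE]. *)
Definition poly_moment p n : R := complex.Re (complex_moment p n).

Definition ecoef d p k : R := (-1) ^+ k * p`_(d - k) / 'C(d, k)%:R.

Definition ffmul d p q : {poly R} :=
  \sum_(k < d.+1)
    ((-1) ^+ k * 'C(d, k)%:R * (ecoef d p k * ecoef d q k)) *: 'X^(d - k).

Lemma ecoefE d p : (size p <= d.+1)%N ->
  p = \sum_(k < d.+1) ((-1) ^+ k * 'C(d, k)%:R * ecoef d p k) *: 'X^(d - k).
Proof.
move=> szp; rewrite -[LHS](coefK p).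
have -> : \poly_(i < size p) p`_i = \poly_(i < d.+1) p`_i.
  apply/polyP => i; rewrite !coef_poly.
  case: (ltnP i (size p)) => [ip|pi]; first by rewrite (leq_trans ip szp).
  by rewrite nth_default // if_same.
rewrite poly_def (reindex_inj rev_ord_inj) /=; apply: eq_bigr => k _.
rewrite subSS /ecoef; congr (_ *: _).
have C0 : 'C(d, k)%:R != 0 :> R.
  by rewrite pnatr_eq0 -lt0n bin_gt0 -ltnS.
by rewrite mulrACA signrMK mulfV// mulr1.
Qed.

Lemma complex_rootsE p : p \is monic ->
  complexify p = \prod_(z <- complex_roots p) ('X - z%:P).
Proof.
rewrite /complex_roots => pm; case: closed_field_poly_normal => s /= ps.
by rewrite ps lead_coef_map (monicP pm) rmorph1 scale1r.
Qed.

Lemma poly_momentE p n : p \is monic ->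
  (poly_moment p n)%:C%C = complex_moment p n.
Proof.
move=> pm; rewrite /poly_moment; apply: RRe_real.
rewrite CrealE /complex_moment.
set s := complex_roots p.
have sE : complexify p = \prod_(z <- s) ('X - z%:P) by exact: complex_rootsE.
have sC : complexify p = \prod_(z <- [seq Num.conj z | z <- s]) ('X - z%:P).
  have -> : complexify p = map_poly Num.conj (complexify p).
    rewrite -map_poly_comp; apply: eq_map_poly => x /=.
    by rewrite (CrealP _) // complex_real.
  rewrite {1}sE rmorph_prod big_map; apply: eq_bigr => z _ /=.
  by rewrite rmorphB /= map_polyX map_polyC.
have ss : perm_eq [seq Num.conj z | z <- s] s.
  by apply/allP => z _ /=; rewrite -!mu_prod_XsubC -sC -sE.
rewrite rmorphM fmorphV rmorph_nat rmorph_sum /=; apply/eqP; congr (_ * _).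
rewrite -[RHS](perm_big _ ss) big_map; apply: eq_bigr => z _.
by rewrite rmorphXn.
Qed.

End Polynomials.

Section NonCrossing.
Variable n : nat.
Implicit Types pi : {set {set 'I_n}}.

Definition noncrossing pi :=
  [forall V in pi, forall W in pi, (V != W) ==>
    ~~ [exists a in V, exists b in W, exists c in V, exists d in W,
          (a < b)%N && (b < c)%N && (c < d)%N]].

Definition NC : {set {set {set 'I_n}}} :=
  [set pi | partition pi [set: 'I_n] & noncrossing pi].

(* [enum] lists a set of ordinals in increasing order, and [next] is the cyclic
   successor in that list, see [block_permE]. *)
Definition block_perm pi : {perm 'I_n} :=
  insubd (1%g : {perm 'I_n}) [ffun i => next (enum (pblock pi i)) i].

Definition long_cycle : {perm 'I_n} := perm (@ordS_inj n).

(* Permutations are multiplied from left to right in MathComp, so that this is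
   the usual product in which the long cycle acts first and the inverse of the
   permutation of [pi] acts second. *)
Definition Kr pi : {set {set 'I_n}} :=
  porbits (long_cycle * (block_perm pi)^-1)%g.

Lemma block_permE pi i : pi \in NC ->
  block_perm pi i = next (enum (pblock pi i)) i.
Proof.
rewrite inE => /andP[/and3P[/eqP cov triv _] _].
rewrite /block_perm /insubd insubT.
  apply/injectiveP => x y; rewrite !ffunE => exy.
  have memp z : z \in pblock pi z by rewrite mem_pblock cov inE.
  have nextp z : next (enum (pblock pi z)) z \in pblock pi z.
    by rewrite -mem_enum mem_next mem_enum.
  have Bxy : pblock pi x = pblock pi y.
    rewrite -(same_pblock triv (nextp x)) exy.
    by rewrite (same_pblock triv (nextp y)).
  rewrite Bxy in exy.
  by rewrite -(prev_next (enum_uniq (pblock pi y)) x) exy prev_next ?enum_uniq.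
by move=> h; rewrite /= -pvalE /= ffunE.
Qed.

End NonCrossing.

Section Cumulants.
Variable R : realType.
Implicit Types u v m : nat -> R.

Definition upart u n (pi : {set {set 'I_n}}) : R := \prod_(V in pi) u #|V|.

Definition dpart v u n (pi : {set {set 'I_n}}) : R :=
  \sum_(V in pi) v #|V| * upart u (pi :\ V).

(* [:: r_0; ...; r_n] with the dummy value r_0 = 0; the moment-cumulant formula
   is solved for the term of the one-block partition, see
   [moment_free_cumulant]. *)
Fixpoint free_cumulant_seq m n : seq R :=
  if n is k.+1 then
    let s := free_cumulant_seq m k in
    rcons s (m n - \sum_(pi in NC n | pi != [set [set: 'I_n]])
                     upart (nth 0 s) pi)
  else [:: 0].

Definition free_cumulant m n : R := (free_cumulant_seq m n)`_n.

Fixpoint inf_free_cumulant_seq m m' n : seq R :=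
  if n is k.+1 then
    let s := inf_free_cumulant_seq m m' k in
    rcons s (m' n - \sum_(pi in NC n | pi != [set [set: 'I_n]])
                      dpart (nth 0 s) (free_cumulant m) pi)
  else [:: 0].

Definition inf_free_cumulant m m' n : R := (inf_free_cumulant_seq m m' n)`_n.

Lemma one_block_NC n : (0 < n)%N -> [set [set: 'I_n]] \in NC n.
Proof.
move=> n0; rewrite inE; apply/andP; split.
  apply/and3P; split.
  - by rewrite /cover big_set1.
  - by rewrite /trivIset /cover !big_set1.
  - by rewrite inE eq_sym -card_gt0 cardsT card_ord.
apply/forall_inP => V; rewrite inE => /eqP->.
by apply/forall_inP => W; rewrite inE => /eqP->; rewrite eqxx.
Qed.

Lemma block_lt n (pi : {set {set 'I_n}}) V :
  pi \in NC n -> pi != [set [set: 'I_n]] -> V \in pi -> (#|V| < n)%N.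
Proof.
rewrite inE => /andP[/and3P[/eqP cov triv p0] _] pi1 Vpi.
rewrite ltnNge; apply: contra pi1 => nV.
have VT : V = [set: 'I_n].
  by apply/eqP; rewrite eqEcard subsetT cardsT card_ord.
apply/eqP/setP => W; rewrite inE; apply/idP/eqP => [Wpi|->]; last first.
  by rewrite -VT.
apply: contraNeq p0 => WT.
have := trivIsetP triv W V Wpi Vpi; rewrite VT => /(_ WT).
by rewrite -setI_eq0 setIT => /eqP <-.
Qed.

Lemma free_cumulant_seqE m n k : (k <= n)%N ->
  (free_cumulant_seq m n)`_k = free_cumulant m k.
Proof.
have sz j : size (free_cumulant_seq m j) = j.+1.
  by elim: j => //= j ih; rewrite size_rcons ih.
elim: n => [|n ih]; first by rewrite leqn0 => /eqP->.
rewrite leq_eqVlt => /predU1P[->//|kn] /=.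
by rewrite nth_rcons sz kn ih.
Qed.

Lemma inf_free_cumulant_seqE m m' n k : (k <= n)%N ->
  (inf_free_cumulant_seq m m' n)`_k = inf_free_cumulant m m' k.
Proof.
have sz j : size (inf_free_cumulant_seq m m' j) = j.+1.
  by elim: j => //= j ih; rewrite size_rcons ih.
elim: n => [|n ih]; first by rewrite leqn0 => /eqP->.
rewrite leq_eqVlt => /predU1P[->//|kn] /=.
by rewrite nth_rcons sz kn ih.
Qed.

Lemma moment_free_cumulant m n : (0 < n)%N ->
  m n = \sum_(pi in NC n) upart (free_cumulant m) pi.
Proof.
case: n => // n _; rewrite (bigD1 [set [set: 'I_n.+1]]) ?one_block_NC//=.
have -> : upart (free_cumulant m) [set [set: 'I_n.+1]] =
    free_cumulant m n.+1.
  by rewrite /upart big_set1 cardsT card_ord.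
have sz j : size (free_cumulant_seq m j) = j.+1.
  by elim: j => //= j ih; rewrite size_rcons ih.
rewrite {1}/free_cumulant /= nth_rcons sz ltnn eqxx.
rewrite -[LHS](subrK (\sum_(pi in NC n.+1 | pi != [set [set: 'I_n.+1]])
   upart (nth 0 (free_cumulant_seq m n)) pi)); congr (_ + _).
apply: eq_bigr => pi /andP[piNC pi1]; apply: eq_bigr => V Vpi.
by rewrite free_cumulant_seqE// -ltnS (block_lt piNC).
Qed.

Lemma moment_inf_free_cumulant m m' n : (0 < n)%N ->
  m' n = \sum_(pi in NC n)
           dpart (inf_free_cumulant m m') (free_cumulant m) pi.
Proof.
case: n => // n _; rewrite (bigD1 [set [set: 'I_n.+1]]) ?one_block_NC//=.
have -> : dpart (inf_free_cumulant m m') (free_cumulant m)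
    [set [set: 'I_n.+1]] = inf_free_cumulant m m' n.+1.
  rewrite /dpart big_set1 cardsT card_ord setDv /upart big_set0.
  by rewrite mulr1.
have sz j : size (inf_free_cumulant_seq m m' j) = j.+1.
  by elim: j => //= j ih; rewrite size_rcons ih.
rewrite {1}/inf_free_cumulant /= nth_rcons sz ltnn eqxx.
rewrite -[LHS](subrK (\sum_(pi in NC n.+1 | pi != [set [set: 'I_n.+1]])
   dpart (nth 0 (inf_free_cumulant_seq m m' n)) (free_cumulant m) pi)).
congr (_ + _).
apply: eq_bigr => pi /andP[piNC pi1]; apply: eq_bigr => V Vpi.
by rewrite inf_free_cumulant_seqE// -ltnS (block_lt piNC).
Qed.

End Cumulants.

(* Imported only now because several names of finset, such as [partition] and
   [pblock], are shadowed by classical_sets. *)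
From mathcomp Require Import all_classical all_reals all_analysis.
Import numFieldNormedType.Exports.

Section Distributions.
Local Open Scope classical_set_scope.
Variable R : realType.

Definition real_law := probability (measurableTypeR R) R.

Implicit Types (mu nu gamma : real_law).

Definition finite_moments mu :=
  forall n, mu.-integrable [set: R] (fun x : R => (x ^+ n)%:E).

Definition moment mu n : R := fine (\int[mu]_x (x ^+ n)%:E)%E.

Definition moment_determinate mu :=
  finite_moments mu /\
  forall nu, finite_moments nu -> (forall n, moment nu n = moment mu n) ->
    forall A : set (measurableTypeR R), measurable A -> nu A = mu A.

Definition fcum mu : nat -> R := free_cumulant (moment mu).

Definition ifcum mu (mu' : {scalar {poly R}}) : nat -> R :=
  inf_free_cumulant (moment mu) (fun n => mu' 'X^n).

Definition has_inf_distribution (p : nat -> {poly R})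
    mu (mu' : {scalar {poly R}}) :=
  [/\ forall d, (0 < d)%N -> monic_of_degree d (p d),
      finite_moments mu,
      forall n, poly_moment (p d) n @[d --> \oo] --> moment mu n,
      mu' 1 = 0
    & forall n, (0 < n)%N ->
        d%:R * (poly_moment (p d) n - moment mu n) @[d --> \oo]
          --> (mu' 'X^n : R)].

(* All distributions are assumed to be determined by their moments, which makes
   the convolution [gamma] below unique. *)
Definition is_free_mul mu nu gamma :=
  [/\ nu [set x : R | x < 0] = 0%E,
      moment_determinate gamma
    & forall n, (0 < n)%N ->
        fcum gamma n =
          \sum_(pi in NC n) upart (fcum mu) pi * upart (fcum nu) (Kr pi)].

Definition is_inf_free_mul mu (mu' : {scalar {poly R}})
    nu (nu' : {scalar {poly R}}) gamma (gamma' : {scalar {poly R}}) :=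
  [/\ is_free_mul mu nu gamma,
      gamma' 1 = 0
    & forall n, (0 < n)%N ->
        ifcum gamma gamma' n = \sum_(pi in NC n)
          (dpart (ifcum mu mu') (fcum mu) pi * upart (fcum nu) (Kr pi) +
           upart (fcum mu) pi * dpart (ifcum nu nu') (fcum nu) (Kr pi))].

End Distributions.

(* Main.v *)
From Stdlib Require Setoid Morphisms.
Require Import Defs.
From mathcomp Require Import all_boot all_order all_algebra all_fingroup.
From mathcomp Require Import zify ring.
From mathcomp Require Import reals complex.

Set Implicit Arguments.
Unset Strict Implicit.
Unset Printing Implicit Defensive.

Import Order.TTheory GRing.Theory Num.Theory.
Local Open Scope ring_scope.

(** Write z for the inverse of the variable x, P for the reversed polynomial of
    p_d, with P(z) = z^d p_d(1/z), and psi(z) for the series of the moments of mu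
    of positive order. Newton's identities say that - z P'/P is the generating
    series of the power sums of the roots of p_d, which is d psi to leading order.
    Since nu is the point mass at 1, the infinitesimal hypothesis on q_d means that
    the power sums of the roots of q_d(x + 1), without any normalisation, converge
    to numbers c_n, and then so do the coefficients of the reversed polynomial of
    q_d(x + 1), to those of a series Q with - Q'/Q = c_1 + c_2 z + c_3 z^2 + ...

    The expansion of q_d in powers of x - 1 turns the finite-free convolution by
    q_d into a differential operator acting on P ([rev_ffmul]). To leading order
    z^j P^(j) / P is (- d psi)^j, so the quotient of the reversed convolution by P
    converges to Q(psi), coefficient by coefficient. Taking logarithmic
    derivatives, the difference between the power sums of the convolution and those
    of p_d converges to the coefficients of theta(psi) cbar(psi), where theta is
    z d/dz and cbar(y) = c_1 + c_2 y + ... ([ffmul_moment_difference]).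

    It remains to see that the infinitesimal free convolution produces the same
    series. The free cumulants of nu vanish beyond the first one and its
    infinitesimal cumulants are exactly the c_n ([inf_cumulant_binomial]). Hence
    gamma has the moments of mu ([convolution_moment]), and only those partitions
    contribute to the second half of the definition of r'(gamma, gamma') whose
    Kreweras complement has one distinguished block W and is discrete elsewhere.
    They are the partitions into cyclic intervals ending at the points of W
    ([Kr_cyclic_intervalsP]), and summing over W adds theta(R) cbar(R) to the
    infinitesimal cumulants, where R is the series of the free cumulants of mu
    ([convolution_cumulants]). Finally, infinitesimal moments depend on
    infinitesimal cumulants through the derivative of the functional equation
    M(z) = 1 + R(z M(z)) ([functional_equation_derivative]), and this linear
    equation transforms theta(R) cbar(R) into theta(psi) cbar(psi)
    ([cumulant_to_moment_series], [convolution_inf_moment]).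

    All series are handled as polynomials modulo a power of X. *)

(** * Congruence of power series modulo a power of X *)

Section Congruence.
Import Setoid Morphisms.
Variable A : comNzRingType.
Implicit Types (p q r : {poly A}) (N : nat).

Definition eqX N p q := forall i, (i < N)%N -> p`_i = q`_i.

Lemma eqX_refl N p : eqX N p p. Proof. by []. Qed.
Lemma eqX_sym N p q : eqX N p q -> eqX N q p.
Proof. by move=> h i iN; rewrite h. Qed.
Lemma eqX_trans N p q r : eqX N p q -> eqX N q r -> eqX N p r.
Proof. by move=> h k i iN; rewrite h ?k. Qed.

#[global] Add Parametric Relation N : {poly A} (eqX N)
  reflexivity proved by (@eqX_refl N)
  symmetry proved by (@eqX_sym N)
  transitivity proved by (@eqX_trans N) as eqX_setoid.

#[global] Instance eqX_add N : Proper (eqX N ==> eqX N ==> eqX N) +%R.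
Proof. by move=> p p' hp q q' hq i iN; rewrite !coefD hp ?hq. Qed.

#[global] Instance eqX_opp N : Proper (eqX N ==> eqX N) -%R.
Proof. by move=> p p' hp i iN; rewrite !coefN hp. Qed.

#[global] Instance eqX_mul N : Proper (eqX N ==> eqX N ==> eqX N) *%R.
Proof.
move=> p p' hp q q' hq i iN; rewrite !coefM; apply: eq_bigr => j _.
by have := ltn_ord j => ji; rewrite hp ?hq //; lia.
Qed.

#[global] Instance eqX_scale N c : Proper (eqX N ==> eqX N) ( *:%R c).
Proof. by move=> p p' hp i iN; rewrite !coefZ hp. Qed.

#[global] Instance eqX_exp N : Proper (eqX N ==> eq ==> eqX N) (@GRing.exp {poly A}).
Proof.
move=> p p' hp n _ <-; elim: n => [|n ih]; first by rewrite !expr0; reflexivity.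
by rewrite !exprS; apply: eqX_mul.
Qed.

Lemma eqX_sum N (I : Type) (l : seq I) (P : pred I) (F G : I -> {poly A}) :
  (forall i, P i -> eqX N (F i) (G i)) ->
  eqX N (\sum_(i <- l | P i) F i) (\sum_(i <- l | P i) G i).
Proof.
by move=> h k kN; rewrite !coef_sum; apply: eq_bigr => i Pi; rewrite h.
Qed.

Lemma eqX0P N p : eqX N p 0 <-> exists r, p = r * 'X^N.
Proof.
split=> [h|[r ->] i iN]; last by rewrite coefMXn iN coef0.
exists (drop_poly N p); rewrite -{1}(poly_take_drop N p).
suff -> : take_poly N p = 0 by rewrite add0r.
apply/polyP => i; rewrite coef_take_poly coef0; case: ifP => // iN.
by rewrite h // coef0.
Qed.

Lemma eqX_sub N p q : eqX N p q <-> eqX N (p - q) 0.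
Proof.
split=> h i iN; first by rewrite coefB h // coef0 subrr.
by apply/eqP; rewrite -subr_eq0 -coefB h ?coef0.
Qed.

Lemma coef0_exp_eqX N p : p`_0 = 0 -> eqX N (p ^+ N) 0.
Proof.
move=> p0; have /eqX0P[r ->] : eqX 1 p 0 by move=> [|//] _; rewrite p0 coef0.
by apply/eqX0P; exists (r ^+ N); rewrite expr1 exprMn.
Qed.

Lemma comp_poly_lincomb N (E : nat -> A) q :
  (\poly_(i < N) E i) \Po q = \sum_(i < N) E i *: q ^+ i.
Proof.
rewrite poly_def linear_sum /=; apply: eq_bigr => i _.
by rewrite comp_polyZ comp_Xn_poly.
Qed.

Lemma eqX_comp_r N p q q' : eqX N q q' -> eqX N (p \Po q) (p \Po q').
Proof.
move=> h; rewrite !comp_polyE; apply: eqX_sum => i _.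
by rewrite h.
Qed.

(** A polynomial divisible by X^N stays so after substitution of a polynomial
    without constant term; this is what makes composition of truncated series
    meaningful. *)
Lemma eqX_comp_l N p p' q : q`_0 = 0 -> eqX N p p' -> eqX N (p \Po q) (p' \Po q).
Proof.
move=> q0 /eqX_sub/eqX0P[r h]; apply/eqX_sub; rewrite -comp_polyB h.
rewrite comp_polyM comp_Xn_poly.
have -> : eqX N (q ^+ N) 0 by apply: coef0_exp_eqX.
by rewrite mulr0.
Qed.

Lemma eqX_cancel N p a b : p`_0 = 1 -> eqX N (p * a) (p * b) -> eqX N a b.
Proof.
move=> p0 h; apply/eqX_sub; move/eqX_sub: h; rewrite -mulrBr.
move: (a - b) => {a b} a h; elim/ltn_ind => i ih iN.
have := h i iN; rewrite coefM big_ord_recl /= p0 mul1r subn0 coef0 big1 ?addr0.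
  by [].
move=> j _; rewrite /bump /= ih ?coef0 ?mulr0 //; have := ltn_ord j; lia.
Qed.

(** A factor without constant term gains one order of precision. It makes up for
    the order lost when a congruence is differentiated. *)
Lemma eqX_shift N p a b : p`_0 = 0 -> eqX N a b -> eqX N.+1 (p * a) (p * b).
Proof.
move=> p0 /eqX_sub/eqX0P[r h]; apply/eqX_sub; rewrite -mulrBr h.
have /eqX0P[s ->] : eqX 1 p 0 by move=> [|//] _; rewrite p0 coef0.
by apply/eqX0P; exists (s * r); rewrite expr1 exprS; ring.
Qed.

(** Truncated generating series. The constant term is dropped rather than read
    from [f], because the cumulant of order 0 is a dummy value and the moment of
    order 0 is separated from the others. *)
Definition pos_series N (f : nat -> A) : {poly A} :=
  \poly_(n < N) (if n is 0%N then 0 else f n).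

(** The Euler operator, used instead of the derivative because it multiplies
    the coefficient of X^i by i and so keeps congruences modulo X^N. *)
Definition theta p := 'X * p^`().

Lemma coef_theta p i : (theta p)`_i = p`_i *+ i.
Proof. by rewrite coefXM coef_deriv; case: i. Qed.

#[global] Instance eqX_theta N : Proper (eqX N ==> eqX N) theta.
Proof. by move=> p q h i iN; rewrite !coef_theta h. Qed.

Lemma thetaM p q : theta (p * q) = theta p * q + p * theta q.
Proof. by rewrite /theta derivM; ring. Qed.

Lemma theta_comp p q : theta (p \Po q) = (p^`() \Po q) * theta q.
Proof. by rewrite /theta deriv_comp; ring. Qed.

Lemma theta_coef0 p : (theta p)`_0 = 0.
Proof. by rewrite coef_theta mulr0n. Qed.

(** Let w = X M and psi = M - 1, so that psi = r(w). Applying theta to this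
    identity gives (1 - X r'(w)) theta(psi) = w r'(w), while the linear equation for
    dM reads (1 - X r'(w)) dM = delta(w) = w r'(w) c(psi). The common factor is
    invertible as a series, and cancels. *)
Lemma cumulant_to_moment_series N (M r delta dM c : {poly A}) :
  eqX N M (1 + (r \Po ('X * M))) ->
  eqX N dM ((delta \Po ('X * M)) + (r^`() \Po ('X * M)) * ('X * dM)) ->
  eqX N delta (theta r * (c \Po r)) ->
  eqX N dM (theta (M - 1) * (c \Po (M - 1))).
Proof.
set w := 'X * M => hM hd hdel; set psi := M - 1; set r' := r^`() \Po w.
have w0 : w`_0 = 0 by rewrite coefXM.
have hpsi : eqX N psi (r \Po w) by rewrite /psi; rewrite hM addrAC subrr add0r.
have M_psi : M = 1 + psi by rewrite /psi addrC subrK.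
have thw : theta w = w + 'X * theta psi.
  by rewrite /w thetaM /theta derivX M_psi derivD derivC; ring.
have hth : eqX N ((1 - 'X * r') * theta psi) (w * r').
  rewrite mulrBl mul1r.
  have E : eqX N (theta psi) (r' * (w + 'X * theta psi)).
    by rewrite {1}hpsi theta_comp thw.
  by rewrite {1}E; apply/eqX_sub; rewrite (_ : _ - _ = 0) //; ring.
apply: (@eqX_cancel _ (1 - 'X * r')).
  by rewrite coefB coefXM coef1 subr0.
have -> : eqX N ((1 - 'X * r') * dM) (delta \Po w).
  rewrite mulrBl mul1r {1}hd -/r'.
  by apply/eqX_sub; rewrite (_ : _ - _ = 0) //; ring.
rewrite mulrA hth (eqX_comp_l w0 hdel) comp_polyM.
rewrite {1}/theta comp_polyM comp_polyX -comp_polyA.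
by rewrite (eqX_comp_r _ hpsi).
Qed.

End Congruence.

(** * Sums over non-crossing partitions *)

(** Arithmetic on ordinals: only the order hypotheses are kept, and the values of
    the ordinals are generalised to natural numbers. *)
Ltac ord_lia :=
  simpl in *;
  repeat match goal with
  | H : ?P |- _ =>
    lazymatch P with
    | is_true (leq _ _) => revert H
    | is_true (andb _ _) => revert H
    | is_true (negb _) => revert H
    | @eq nat _ _ => revert H
    | not _ => revert H
    | _ => clear H
    end
  end;
  repeat match goal with
  | |- context [nat_of_ord ?x] => generalize (nat_of_ord x)
  end; clear; intros; lia.

Lemma big_setU_disjoint (A : comNzRingType) (T : finType) (X Y : {set T})
    (f : T -> A) : [disjoint X & Y] ->
  \prod_(i in X :|: Y) f i = \prod_(i in X) f i * \prod_(i in Y) f i.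
Proof.
move=> XY; rewrite -bigU //; apply: eq_bigl => i.
by rewrite inE.
Qed.

Section PartitionPoints.
Variable T : finType.
Implicit Types (P : {set {set T}}) (D : {set T}).

Lemma partition_pointwise P D :
  (forall x, x \in D -> exists2 B, B \in P & x \in B) ->
  (forall B, B \in P -> B \subset D) -> set0 \notin P ->
  (forall B C x, B \in P -> C \in P -> x \in B -> x \in C -> B = C) ->
  partition P D.
Proof.
move=> cov sub P0 uniq; apply/and3P; split => //.
- apply/eqP/setP => x; apply/bigcupP/idP => [[B BP xB]|/cov[B BP xB]].
    exact: subsetP (sub B BP) _ xB.
  by exists B.
- apply/trivIsetP => B C BP CP BC; rewrite -setI_eq0; apply/eqP/setP => x.
  rewrite !inE; apply/negbTE; apply: contra BC => /andP[xB xC].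
  by apply/eqP; apply: uniq xB xC.
Qed.

Lemma partition_same P D B C x : partition P D ->
  B \in P -> C \in P -> x \in B -> x \in C -> B = C.
Proof.
move=> /partition_trivIset tP BP CP xB xC.
by rewrite -(def_pblock tP BP xB) (def_pblock tP CP xC).
Qed.

Lemma partition_block P D x : partition P D -> x \in D ->
  pblock P x \in P /\ x \in pblock P x.
Proof.
move=> PD xD; have xc : x \in cover P by rewrite (cover_partition PD).
by rewrite pblock_mem // mem_pblock.
Qed.

End PartitionPoints.

Section NonCrossing.
Variable N : nat.
Implicit Types (pi : {set {set 'I_N}}) (D V W : {set 'I_N}) (a b c : 'I_N).

Lemma noncrossingP pi :
  (forall V W a b c d, V \in pi -> W \in pi -> a \in V -> b \in W ->
     c \in V -> d \in W -> (a < b)%N -> (b < c)%N -> (c < d)%N -> V = W) <->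
  noncrossing pi.
Proof.
split=> [nc|].
  apply/forall_inP => V Vpi; apply/forall_inP => W Wpi.
  apply/implyP => VW; apply/negP => /exists_inP[a aV /exists_inP[b bW]].
  move=> /exists_inP[c cV /exists_inP[d dW /andP[/andP[ab bc] cd]]].
  by case/eqP: VW; apply: (nc V W a b c d).
move=> nc V W a b c d Vpi Wpi aV bW cV dW ab bc cd; apply/eqP.
apply: contraT => VW.
move/forall_inP/(_ _ Vpi)/forall_inP/(_ _ Wpi)/implyP/(_ VW)/negP: nc; case.
apply/exists_inP; exists a => //; apply/exists_inP; exists b => //.
apply/exists_inP; exists c => //; apply/exists_inP; exists d => //.
by rewrite ab bc cd.
Qed.

Definition NC_of D : {set {set {set 'I_N}}} :=
  [set pi | partition pi D & noncrossing pi].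

Definition segment (a b : nat) : {set 'I_N} := [set i : 'I_N | (a <= i < b)%N].

End NonCrossing.

Section Recurrence.
Variables (A : comNzRingType) (u : nat -> A) (N : nat).
Implicit Types (pi : {set {set 'I_N}}) (D V W : {set 'I_N}).

(** The block of [a] counts with [j] additional elements. This extra parameter
    makes the decomposition of a partition at the second element of its first block
    recursive: the first element is removed, and remembered in [j]. *)
Definition marked_weight j (a : 'I_N) pi : A :=
  \prod_(V in pi) u (#|V| + (a \in V) * j)%N.

Definition marked_sum j (a : 'I_N) D : A :=
  \sum_(pi in NC_of D) marked_weight j a pi.

(** Splitting at the second element [c] of the block of the minimum [a]: what
    lies strictly between [a] and [c] is partitioned on its own, because a block
    leaving that gap would cross the block of [a] and [c], and what lies from [c] on
    is a partition to whose block of [c] the point [a] is added. [phi] glues the two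
    parts and [psi] recovers them. *)
Section Split.
Variables (j : nat) (a c : 'I_N) (b : nat).
Hypotheses (ac : (a < c)%N) (cb : (c < b)%N).

Let G := segment N a.+1 c.
Let T := segment N c b.
Let D := segment N a b.
Let h (B : {set 'I_N}) := if c \in B then a |: B else B.
Let phi (x : {set {set 'I_N}} * {set {set 'I_N}}) := x.1 :|: (h @: x.2).

Definition is_second pi (x : 'I_N) :=
  [&& (a < x)%N, x \in pblock pi a & pblock pi a :&: segment N a.+1 x == set0].

Let aT : a \notin T. Proof. by rewrite inE; ord_lia. Qed.
Let aG : a \notin G. Proof. by rewrite inE; ord_lia. Qed.

Let hP B x : (x \in h B) = (x \in B) || (x == a) && (c \in B).
Proof.
rewrite /h; case: ifP => cB; last by rewrite andbF orbF.
by rewrite in_setU1 andbT orbC.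
Qed.

Let psi pi : {set {set 'I_N}} * {set {set 'I_N}} :=
  ([set B in pi | B \subset G], [set B :\ a | B in pi & ~~ (B \subset G)]).

Section Forward.
Variables pi1 pi2 : {set {set 'I_N}}.
Hypotheses (P1 : pi1 \in NC_of G) (P2 : pi2 \in NC_of T).

Let part1 : partition pi1 G. Proof. by move: P1; rewrite inE => /andP[]. Qed.
Let part2 : partition pi2 T. Proof. by move: P2; rewrite inE => /andP[]. Qed.
Let sub1 B x : B \in pi1 -> x \in B -> (a < x < c)%N.
Proof. by move=> /(partitionS part1)/subsetP s /s; rewrite inE. Qed.
Let sub2 B x : B \in pi2 -> x \in B -> (c <= x < b)%N.
Proof. by move=> /(partitionS part2)/subsetP s /s; rewrite inE. Qed.
Let subh B x : B \in pi2 -> x \in h B -> x = a \/ (c <= x < b)%N.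
Proof.
by move=> Bp; rewrite hP => /orP[/(sub2 Bp)|/andP[/eqP->]]; [right|left].
Qed.
Let hD B : B \in pi2 -> (h B) :\ a = B.
Proof.
move=> Bp; apply/setP => x; rewrite in_setD1 hP.
have [->|xa] /= := eqVneq x a; last by rewrite orbF.
by apply/esym/negP => /(sub2 Bp); ord_lia.
Qed.
Let hI : {in pi2 &, injective h}.
Proof. by move=> B C /hD {2}<- /hD {2}<- ->. Qed.

Let pi0 := phi (pi1, pi2).

Let pi0P V : V \in pi0 -> V \in pi1 \/ exists2 B, B \in pi2 & V = h B.
Proof. by rewrite !inE => /orP[|/imsetP[B Bp ->]]; [left|right; exists B]. Qed.

Let in1 V : V \in pi1 -> V \in pi0.
Proof. by move=> Vp; rewrite !inE Vp. Qed.
Let in2 B : B \in pi2 -> h B \in pi0.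
Proof. by move=> Vp; rewrite !inE imset_f ?orbT. Qed.

Let part0 : partition pi0 D.
Proof.
have cT : c \in T by rewrite inE; ord_lia.
have [T0 Tc] := partition_block part2 cT.
apply: partition_pointwise.
- move=> x; rewrite inE => xD.
  case: (ltnP a x) => ax; last first.
    have -> : x = a by apply/val_inj => /=; ord_lia.
    exists (h (pblock pi2 c)); first exact: in2.
    by rewrite hP eqxx Tc ?orbT.
  case: (ltnP x c) => xc.
    have xG : x \in G by rewrite inE; ord_lia.
    have [B1 B2] := partition_block part1 xG.
    by exists (pblock pi1 x) => //; apply: in1.
  have xT : x \in T by rewrite inE; ord_lia.
  have [B1 B2] := partition_block part2 xT.
  by exists (h (pblock pi2 x)); [apply: in2 | rewrite hP B2].
- move=> V /pi0P[Vp|[B Bp ->]]; apply/subsetP => x.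
    by move/(sub1 Vp); rewrite inE; ord_lia.
  by move=> /(subh Bp)[->|]; rewrite inE; ord_lia.
- apply/negP => /pi0P[|[B Bp]]; first by rewrite (partition0 part1).
  have [B0|[x xB]] := set_0Vmem B.
    by move: Bp; rewrite B0 (partition0 part2).
  by move/setP/(_ x); rewrite inE hP xB.
- move=> V W x /pi0P[Vp|[B Bp ->]] /pi0P[Wp|[C Cp ->]].
  + exact: partition_same part1 Vp Wp.
  + by move=> /(sub1 Vp) ? /(subh Cp)[|]; [move=> xa; subst x|]; ord_lia.
  + move=> xB /(sub1 Wp) xD.
    by have := subh Bp xB => - [xa|]; [subst x|]; ord_lia.
  + rewrite !hP; have [->|xa] := eqVneq x a; last first.
      rewrite !orbF => xB xC.
      by rewrite (partition_same part2 Bp Cp xB xC).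
    have na E : E \in pi2 -> (a \in E) = false.
      by move=> Ep; apply/negP => /(sub2 Ep); ord_lia.
    rewrite !na //= => cB cC.
    by rewrite (partition_same part2 Bp Cp cB cC).
Qed.

Let nc0 : noncrossing pi0.
Proof.
have nc1 : noncrossing pi1 by move: P1; rewrite inE => /andP[].
have nc2 : noncrossing pi2 by move: P2; rewrite inE => /andP[].
apply/noncrossingP => V W p q r s /pi0P[Vp|[B Bp ->]] /pi0P[Wp|[C Cp ->]].
- by move=> pV qW rV sW; apply: (proj2 (noncrossingP pi1) nc1 V W p q r s).
- move=> /(sub1 Vp) p1 /(subh Cp) [->|q1] /(sub1 Vp) r1 _; ord_lia.
- by move=> _ /(sub1 Wp) q1 /(subh Bp)[->|r1] /(sub1 Wp) s1; ord_lia.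
- move=> pV qW rV sW pq qr rs; congr h.
  have pD : (a <= p)%N by have [->|] := subh Bp pV; ord_lia.
  have nE (x : 'I_N) E : (a < x)%N -> x \in h E -> x \in E.
    move=> ax; rewrite hP => /orP[//|/andP[/eqP xa _]].
    by move: ax; rewrite xa ltnn.
  have qC : q \in C by apply: nE qW; ord_lia.
  have rB : r \in B by apply: nE rV; ord_lia.
  have sC : s \in C by apply: nE sW; ord_lia.
  have q1 := sub2 Cp qC.
  have [pa|p1] := subh Bp pV; last first.
    have pB : p \in B by apply: nE pV; ord_lia.
    exact: (proj2 (noncrossingP pi2) nc2 B C p q r s).
  have cB : c \in B.
    move: pV; rewrite hP pa eqxx /= => /orP[aB|//].
    by have := sub2 Bp aB; ord_lia.
  have [qc|qc] := eqVneq q c.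
    by apply: (partition_same part2 Bp Cp cB); rewrite -qc.
  apply: (proj2 (noncrossingP pi2) nc2 B C c q r s) => //.
  have /eqP : val q != val c by [].
  move: q1 => /=; ord_lia.
Qed.

Let phi_second : is_second pi0 c.
Proof.
have cT : c \in T by rewrite inE; ord_lia.
have [B1 B2] := partition_block part2 cT.
have -> : is_second pi0 c =
  [&& (a < c)%N, c \in h (pblock pi2 c) & h (pblock pi2 c) :&: G == set0].
  rewrite /is_second (def_pblock (partition_trivIset part0) (in2 B1)) //.
  by rewrite hP eqxx B2 orbT.
rewrite ac hP B2 /=; apply/eqP/setP => x; rewrite in_setI in_set0.
apply/negP => /andP[/(subh B1) + xG]; move: xG; rewrite inE => xG.
by case=> [xa|]; [subst x|]; ord_lia.
Qed.

Let phiK : psi pi0 = (pi1, pi2).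
Proof.
have hG B : B \in pi2 -> h B \subset G = false.
  move=> Bp; apply/negP => /subsetP s.
  have [B0|[x xB]] := set_0Vmem B.
    by move: Bp; rewrite B0 (partition0 part2).
  have := s x; rewrite hP xB => /(_ isT); rewrite inE.
  by have := sub2 Bp xB; ord_lia.
congr (_, _); apply/setP => V.
  rewrite !inE; apply/andP/idP => [[/orP[//|/imsetP[B Bp ->]]]|Vp].
    by rewrite hG.
  by rewrite Vp (partitionS part1 Vp).
apply/imsetP/idP => [[B]|Vp].
  rewrite inE => /andP[/pi0P[Bp|[C Cp ->]]].
    by rewrite (partitionS part1 Bp).
  by move=> _ ->; rewrite hD.
by exists (h V); rewrite ?hD // inE in2 // hG.
Qed.

Let phi_weight : marked_weight j a pi0 =
  marked_weight 0 a pi1 * marked_weight j.+1 c pi2.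
Proof.
have na E : E \in pi2 -> (a \in E) = false.
  by move=> Ep; apply/negP => /(sub2 Ep); ord_lia.
rewrite /marked_weight /pi0 /phi /= big_setU_disjoint; last first.
  rewrite -setI_eq0; apply/eqP/setP => V; rewrite in_setI in_set0.
  apply/negP => /andP[Vp /imsetP[B Bp VE]].
  have [B0|[x xB]] := set_0Vmem B.
    by move: Bp; rewrite B0 (partition0 part2).
  have := sub2 Bp xB; have := sub1 Vp (x := x).
  by rewrite VE hP xB => /(_ isT); ord_lia.
congr (_ * _).
  apply: eq_bigr => V Vp; congr u; rewrite muln0 addn0.
  case: (boolP (a \in V)) => [/(sub1 Vp)|]; first ord_lia.
  by rewrite mul0n addn0.
rewrite big_imset //; apply: eq_bigr => B Bp; congr u.
rewrite hP (na B Bp) eqxx /= /h; case: ifP => cB //=.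
by rewrite cardsU1 (na B Bp) /=; ord_lia.
Qed.

Lemma split_forward :
  [/\ pi0 \in NC_of D, is_second pi0 c, psi pi0 = (pi1, pi2) &
   marked_weight j a pi0 = marked_weight 0 a pi1 * marked_weight j.+1 c pi2].
Proof. by split; rewrite // inE part0 nc0. Qed.

End Forward.

Section Backward.
Variable pi : {set {set 'I_N}}.
Hypotheses (P : pi \in NC_of D) (sec : is_second pi c).

Let part : partition pi D. Proof. by move: P; rewrite inE => /andP[]. Qed.
Let nc : noncrossing pi. Proof. by move: P; rewrite inE => /andP[]. Qed.
Let V := pblock pi a.
Let aD : a \in D. Proof. by rewrite inE; ord_lia. Qed.
Let Vpi : V \in pi. Proof. by have [] := partition_block part aD. Qed.
Let aV : a \in V. Proof. by have [] := partition_block part aD. Qed.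
Let cV : c \in V. Proof. by case/and3P: sec. Qed.
Let VG x : x \in V -> x \in G = false.
Proof.
by case/and3P: sec => _ _ /eqP/setP/(_ x); rewrite !in_setI in_set0 => + xV; rewrite xV.
Qed.

Let sub B x : B \in pi -> x \in B -> (a <= x < b)%N.
Proof. by move=> /(partitionS part)/subsetP s /s; rewrite inE. Qed.

Let ncpi := proj2 (noncrossingP pi) nc.

(* A block meeting both the gap and its complement would cross the block of a. *)
Let dich B : B \in pi -> ~~ (B \subset G) -> forall x, x \in B -> x \notin G.
Proof.
move=> Bp /subsetPn[y yB yG] x xB; apply/negP => xG.
have BV : B <> V by move=> BE; rewrite VG // -BE in xG.
have := sub Bp yB => yD; have := xG; rewrite inE => xD.
have ya : y != a.
  apply/negP => /eqP ya; apply: BV.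
  by apply: (partition_same part Bp Vpi yB); rewrite ya.
have yc : y != c.
  apply/negP => /eqP yc; apply: BV.
  by apply: (partition_same part Bp Vpi yB); rewrite yc.
have /eqP ya' : val y != val a by [].
have /eqP yc' : val y != val c by [].
move: yG; rewrite inE => yG.
by apply: BV; apply/esym; apply: (ncpi (a := a) (b := x) (c := c) (d := y)) => //;
  move: ya' yc' => /=; ord_lia.
Qed.

Let Ghalf : (psi pi).1 \in NC_of G.
Proof.
rewrite inE; apply/andP; split.
  apply: partition_pointwise.
  - move=> x xG; have xD : x \in D by move: xG; rewrite !inE; ord_lia.
    have [B1 B2] := partition_block part xD.
    exists (pblock pi x) => //; rewrite inE B1.
    by apply: contraT => /(dich B1)/(_ x B2); rewrite xG.
  - by move=> B; rewrite inE => /andP[].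
  - by rewrite inE (partition0 part).
  - by move=> B C x; rewrite !inE => /andP[Bp _] /andP[Cp _]; apply: partition_same part _ _.
apply/noncrossingP => B C p q r s; rewrite !inE => /andP[Bp _] /andP[Cp _].
exact: ncpi.
Qed.

Let Thalf : (psi pi).2 \in NC_of T.
Proof.
have G0 : ~~ (V \subset G) by apply/subsetPn; exists a.
rewrite inE; apply/andP; split.
  apply: partition_pointwise.
  - move=> x; rewrite inE => xT.
    have xD : x \in D by rewrite inE; ord_lia.
    have [B1 B2] := partition_block part xD.
    exists (pblock pi x :\ a).
      apply: imset_f; rewrite inE B1 /=; apply/subsetPn; exists x => //.
      by rewrite inE; ord_lia.
    by rewrite in_setD1 B2 andbT; apply/eqP => xa; subst x; ord_lia.
  - move=> B0 /imsetP[B]; rewrite inE => /andP[Bp BG] ->.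
    apply/subsetP => x; rewrite in_setD1 => /andP[xa xB].
    have := dich Bp BG xB; have := sub Bp xB; rewrite !inE.
    by have /eqP : val x != val a by []; move=> /=; ord_lia.
  - apply/negP => /imsetP[B]; rewrite inE => /andP[Bp BG] /esym/eqP.
    rewrite setD_eq0 => Ba.
    have [B0|[x xB]] := set_0Vmem B.
      by move: Bp; rewrite B0 (partition0 part).
    have := subsetP Ba x xB; rewrite inE => /eqP xa; subst x.
    have BV := partition_same part Bp Vpi xB aV.
    have := subsetP Ba c; rewrite BV cV inE => /(_ isT)/eqP ca.
    by move: ac; rewrite ca ltnn.
  - move=> B0 C0 x /imsetP[B]; rewrite inE => /andP[Bp _] ->.
    move=> /imsetP[C]; rewrite inE => /andP[Cp _] ->.
    rewrite !in_setD1 => /andP[_ xB] /andP[_ xC].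
    by rewrite (partition_same part Bp Cp xB xC).
apply/noncrossingP => B0 C0 p q r s.
move=> /imsetP[B]; rewrite inE => /andP[Bp _] ->.
move=> /imsetP[C]; rewrite inE => /andP[Cp _] ->.
rewrite !in_setD1 => /andP[_ pB] /andP[_ qC] /andP[_ rB] /andP[_ sC] pq qr rs.
by rewrite (ncpi Bp Cp pB qC rB sC pq qr rs).
Qed.

Let psiK : phi (psi pi) = pi.
Proof.
have hB B : B \in pi -> ~~ (B \subset G) -> h (B :\ a) = B.
  move=> Bp BG; apply/setP => x; rewrite hP !in_setD1.
  have ca : c != a by apply/eqP => E; move: ac; rewrite E ltnn.
  have [->|xa] /= := eqVneq x a; last by rewrite orbF.
  rewrite ca /=; apply/idP/idP => [cB|aB].
    by rewrite (partition_same part Bp Vpi cB cV).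
  by rewrite (partition_same part Bp Vpi aB aV).
apply/setP => B; rewrite in_setU; apply/orP/idP => [[]|Bp].
- by rewrite inE => /andP[].
- by move=> /imsetP[C0 /imsetP[C]]; rewrite inE => /andP[Cp CG] -> ->; rewrite hB.
- case: (boolP (B \subset G)) => BG; first by left; rewrite inE Bp.
  right; apply/imsetP; exists (B :\ a); last by rewrite hB.
  by apply: imset_f; rewrite inE Bp.
Qed.

Lemma split_backward :
  [/\ (psi pi).1 \in NC_of G, (psi pi).2 \in NC_of T & phi (psi pi) = pi].
Proof. by []. Qed.

End Backward.

Lemma marked_sum_second :
  \sum_(pi in NC_of D | is_second pi c) marked_weight j a pi =
  marked_sum 0 a G * marked_sum j.+1 c T.
Proof.
rewrite /marked_sum big_distrlr /= pair_big /=.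
rewrite (reindex_onto phi psi) /=; last first.
  by move=> pi /andP[P sec]; have [_ _ ->] := split_backward P sec.
apply: eq_big => [[pi1 pi2]|[pi1 pi2] /andP[/andP[P sec] /eqP E]] /=; last first.
  have [] := split_backward P sec; rewrite E => P1 P2 _.
  by have [] := split_forward P1 P2.
apply/idP/andP => [/andP[/andP[P sec] /eqP E]|[P1 P2]].
  by have [] := split_backward P sec; rewrite E => P1 P2 _; split.
by have [-> -> -> _] := split_forward P1 P2; rewrite eqxx.
Qed.

End Split.

End Recurrence.

Section MarkedSumRecurrence.
Variables (A : comNzRingType) (u : nat -> A) (N : nat).
Implicit Types (pi : {set {set 'I_N}}) (D V W : {set 'I_N}).

(** If the first element is a block, removing it leaves an arbitrary non-crossing
    partition of the rest. *)
Lemma marked_sum_singleton j (a : 'I_N) b : (a < b)%N ->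
  \sum_(pi in NC_of (segment N a b) | [set a] \in pi) marked_weight u j a pi =
  u j.+1 * marked_sum u 0 a (segment N a.+1 b).
Proof.
move=> ab; set D := segment N a b; set E := segment N a.+1 b.
have aE : a \notin E by rewrite inE; ord_lia.
have DE : D = a |: E.
  apply/setP => x; rewrite !inE; have [->|xa] /= := eqVneq x a; first ord_lia.
  by have /eqP : val x != val a by []; ord_lia.
have ED : E = D :\: [set a].
  apply/setP => x; rewrite DE !inE; have [->|xa] //= := eqVneq x a.
  by ord_lia.
rewrite /marked_sum mulr_sumr.
rewrite (reindex_onto (fun pi1 => [set a] |: pi1) (fun pi => pi :\ [set a])) /=;
  last by move=> pi /andP[_ api]; rewrite setD1K.
have aN pi1 : partition pi1 E -> forall B, B \in pi1 -> a \notin B.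
  by move=> P1 B Bp; apply: contra aE; apply: subsetP (partitionS P1 Bp) a.
have aN' pi1 : partition pi1 E -> [set a] \notin pi1.
  by move=> P1; apply/negP => /(aN _ P1); rewrite set11.
apply: eq_big => [pi1|pi1 /andP[/andP[+ _] /eqP pi1E]]; last first.
  rewrite inE => /andP[P _].
  have P1 : partition pi1 E.
    by rewrite ED -pi1E; apply: partitionD1; rewrite // setU11.
  rewrite /marked_weight big_setU1 ?aN' //= cards1 set11 mul1n; congr (_ * _).
  by apply: eq_bigr => V Vp; rewrite (negbTE (aN _ P1 _ Vp)) muln0.
apply/idP/idP => [/andP[/andP[+ _] /eqP pi1E]|].
  rewrite !inE => /andP[P nc]; apply/andP; split.
    by rewrite ED -pi1E; apply: partitionD1; rewrite // setU11.
  apply/noncrossingP => V W p q r s Vp Wp.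
  by apply: (proj2 (noncrossingP _) nc); rewrite inE ?Vp ?Wp orbT.
rewrite !inE eqxx /= => /andP[P nc]; rewrite andbT.
rewrite setU1K ?aN' // eqxx andbT; apply/andP; split.
  rewrite DE; apply: partitionU1 => //; first by apply/set0Pn; exists a; rewrite inE.
  by rewrite -setI_eq0; apply/eqP/setP => x; rewrite !inE;
    have [->|//] := eqVneq x a; rewrite ltnn.
apply/noncrossingP => V W p q r s; rewrite !inE.
case/orP => [/eqP->|Vp]; case/orP => [/eqP->|Wp] //.
- by rewrite !inE => /eqP-> _ /eqP->; ord_lia.
- by rewrite !inE => _ /eqP-> _ /eqP->; ord_lia.
- exact: (proj2 (noncrossingP _) nc).
Qed.

Lemma marked_sum_rec j (a : 'I_N) b : (a < b)%N ->
  marked_sum u j a (segment N a b) = u j.+1 * marked_sum u 0 a (segment N a.+1 b)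
   + \sum_(c : 'I_N | (a < c < b)%N) marked_sum u 0 a (segment N a.+1 c) *
        marked_sum u j.+1 c (segment N c b).
Proof.
move=> ab; rewrite {1}/marked_sum (bigID (fun pi => [set a] \in pi)) /=.
rewrite marked_sum_singleton //; congr (_ + _).
(* The default value a is never taken, since {a} is not a block. *)
pose sec pi := odflt a [pick c | is_second a pi c].
have aD : a \in segment N a b by rewrite inE; ord_lia.
have secP pi : pi \in NC_of (segment N a b) -> [set a] \notin pi ->
    is_second a pi (sec pi).
  rewrite inE => /andP[P nc] api; rewrite /sec; case: pickP => [//|no].
  have [Vp aV] := partition_block P aD.
  have : pblock pi a :\ a != set0.
    apply: contra api; rewrite setD_eq0 subset1 => /orP[/eqP VE|/eqP VE].
      by rewrite -VE.
    by move: aV; rewrite VE inE.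
  case/set0Pn => x0 x0P.
  case: (@arg_minnP _ x0 (fun i => i \in pblock pi a :\ a) (@nat_of_ord N) x0P).
  move=> c cP cmin.
  have := cP; rewrite in_setD1 => /andP[ca cV].
  have cD := subsetP (partitionS P Vp) c cV.
  have := no c; rewrite /is_second cV.
  have -> : (a < c)%N.
    by move: cD; rewrite inE; have /eqP : val c != val a by []; ord_lia.
  rewrite /= => /negP; case; apply/eqP/setP => y; rewrite in_setI in_set0.
  apply/negP => /andP[yV]; rewrite inE => /andP[ay yc].
  have := cmin y; rewrite in_setD1 yV andbT => /(_ _).
  have -> : y != a by apply/eqP => ya; subst y; ord_lia.
  by move=> /(_ isT); ord_lia.
have secU pi c d : is_second a pi c -> is_second a pi d -> c = d.
  wlog cd : c d / (c < d)%N => [th|].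
    case: (ltngtP c d) => [cd|dc|/val_inj//] H1 H2; first exact: th.
    by apply/esym/th.
  move=> /and3P[ac cV _] /and3P[ad _ /eqP/setP/(_ c)].
  by rewrite in_setI cV in_set0 inE ac cd.
rewrite (partition_big sec (fun c : 'I_N => (a < c < b)%N)) /=; last first.
  move=> pi /andP[pinc api]; have /and3P[ac cV _] := secP pi pinc api.
  move: pinc; rewrite inE => /andP[P nc].
  have [Vp aV] := partition_block P aD.
  by have := subsetP (partitionS P Vp) _ cV; rewrite inE; ord_lia.
apply: eq_bigr => c /andP[ac cb].
rewrite -marked_sum_second //; apply: eq_bigl => pi.
case: (boolP (pi \in _)) => //= pinc; apply/andP/idP => [[api /eqP <-]|cP].
  exact: secP.
have api : [set a] \notin pi.
  apply/negP => api; move: cP => /and3P[_ + _].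
  have [+ _] := setIdP pinc.
  move=> P; rewrite (def_pblock (partition_trivIset P) api) ?set11 //.
  by rewrite inE => /eqP ca; move: ac; rewrite ca ltnn.
by split=> //; apply/eqP; apply: secU (secP pi pinc api) cP.
Qed.

Lemma marked_sum_empty j (a : 'I_N) x y : (y <= x)%N ->
  marked_sum u j a (segment N x y) = 1.
Proof.
move=> yx; have -> : segment N x y = set0.
  by apply/setP => i; rewrite !inE; ord_lia.
rewrite /marked_sum (eq_bigl (pred1 set0)).
  by rewrite big_pred1_eq /marked_weight big_set0.
move=> pi; rewrite inE partition_set0 /=; case: eqP => //= ->.
by apply/noncrossingP => V W p q r s; rewrite inE.
Qed.

Lemma marked_sum0 (a b : 'I_N) D : marked_sum u 0 a D = marked_sum u 0 b D.
Proof.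
apply: eq_bigr => pi _; apply: eq_bigr => V _.
by rewrite !muln0.
Qed.

End MarkedSumRecurrence.

Section NoncrossingSum.
Variables (A : comNzRingType) (u : nat -> A).

(** The recursion of [marked_sum_rec] on sizes only. The recursive calls are on
    smaller sizes but not on the predecessor, hence the bound [f] on the depth. *)
Fixpoint nc_fuel f j n : A :=
  match f, n with
  | g.+1, m.+1 => u j.+1 * nc_fuel g 0 m
                  + \sum_(i < m) nc_fuel g 0 i * nc_fuel g j.+1 (m - i)%N
  | _, _ => 1
  end.

Definition nc_sum j n := nc_fuel n j n.

Lemma nc_fuel_enough f g j n : (n <= f)%N -> (n <= g)%N ->
  nc_fuel f j n = nc_fuel g j n.
Proof.
elim: f g j n => [|f ih] [|g] j [|n] //= nf ng.
rewrite (ih g) //; congr (_ + _); apply: eq_bigr => i _.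
have im := ltn_ord i.
by rewrite (ih g) ?(ih g j.+1) //; ord_lia.
Qed.

Lemma nc_sumS j m :
  nc_sum j m.+1 = u j.+1 * nc_sum 0 m
    + \sum_(i < m) nc_sum 0 i * nc_sum j.+1 (m - i)%N.
Proof.
rewrite /nc_sum /=; congr (_ + _); apply: eq_bigr => i _.
have im := ltn_ord i.
by congr (_ * _); apply: nc_fuel_enough; ord_lia.
Qed.

(** Both sides obey the same recursion, so that the sum depends on the interval
    through its length only; no relabelling of partitions is involved. The mark [a]
    matters only if [j] is not zero. *)
Lemma marked_sum_nc_sum N j (a : 'I_N) x n : (x + n <= N)%N ->
  j = 0 \/ x = a -> marked_sum u j a (segment N x (x + n)%N) = nc_sum j n.
Proof.
elim/ltn_ind: n j a x => -[|m] ih j a x xN ja.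
  by rewrite marked_sum_empty // addn0.
have xN' : (x < N)%N by ord_lia.
have -> : marked_sum u j a (segment N x (x + m.+1)%N) =
    marked_sum u j (Ordinal xN') (segment N (Ordinal xN') (x + m.+1)%N).
  case: ja => [->|xa]; first exact: marked_sum0.
  by congr (marked_sum _ _ _ _); apply: val_inj.
rewrite marked_sum_rec /=; last by ord_lia.
rewrite nc_sumS; congr (_ * _ + _).
  have -> : (x + m.+1 = x.+1 + m)%N by lia.
  by apply: ih; [| lia | left].
rewrite (eq_bigr (fun c : 'I_N =>
  nc_sum 0 (c - x.+1)%N * nc_sum j.+1 (x + m.+1 - c)%N)); last first.
  move=> c /andP[xc cm].
  have E1 : nat_of_ord c = (x.+1 + (c - x.+1))%N by lia.
  have E2 : (x + m.+1 = c + (x + m.+1 - c))%N by lia.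
  congr (_ * _).
    by rewrite {1}E1; apply: ih; [lia | lia | left].
  by rewrite {1}E2; apply: ih; [lia | lia | right].
rewrite (big_ord_widen_cond N predT (fun i => nc_sum 0 i * nc_sum j.+1 (m - i)%N)) /=; last lia.
rewrite -(big_mkord (fun i => (i < m)%N) (fun i => nc_sum 0 i * nc_sum j.+1 (m - i)%N)).
rewrite -(big_mkord (fun c => (x < c < x + m.+1)%N) (fun c =>
  nc_sum 0 (c - x.+1)%N * nc_sum j.+1 (x + m.+1 - c)%N)).
rewrite -(big_nat_widen 0 m N predT) /=; last lia.
rewrite (@big_cat_nat _ _ _ x.+1) //=.
rewrite [X in X + _]big_nat_cond big1 ?add0r; last by move=> i; lia.
rewrite (@big_cat_nat _ _ _ (x + m.+1)) //=; last lia.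
rewrite [X in _ + X]big_nat_cond [X in _ + X]big1 ?addr0; last by move=> i; lia.
etransitivity; first exact: (big_addn 0 _ x.+1).
have -> : (x + m.+1 - x.+1 = m)%N by lia.
rewrite big_nat_cond [RHS]big_nat_cond; apply: eq_big => i.
  by lia.
by move=> ?; congr (nc_sum _ _ * nc_sum _ _); lia.
Qed.

Lemma NC_sumE n : \sum_(pi in NC n) \prod_(V in pi) u #|V| = nc_sum 0 n.
Proof.
case: n => [|n].
  rewrite /nc_sum /= (eq_bigl (pred1 set0)).
    by rewrite big_pred1_eq big_set0.
  have T0 : [set: 'I_0] = set0 by apply/setP => -[].
  move=> pi; rewrite inE T0 partition_set0 /=; case: eqP => //= ->.
  by apply/noncrossingP => V W p q r s; rewrite inE.
rewrite -(@marked_sum_nc_sum n.+1 0 ord0 0) //; last by left.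
have -> : segment n.+1 0 (0 + n.+1)%N = setT.
  by apply/setP => i; rewrite !inE /= add0n ltn_ord.
apply: eq_bigr => pi _; apply: eq_bigr => V _.
by rewrite muln0 addn0.
Qed.

End NoncrossingSum.

(** * The functional equation of moments and free cumulants *)

Section FunctionalEquation.
Variables (A : comNzRingType) (u : nat -> A) (N : nat).

Definition nc_series : {poly A} := \poly_(n < N) nc_sum u 0 n.

Let w := 'X * nc_series.
Let tail j : {poly A} := pos_series N (nc_sum u j).

Lemma tail_rec j : eqX N (tail j) (w * ((u j.+1)%:P + tail j.+1)).
Proof.
move=> [|n] nN; first by rewrite -mulrA coefXM coef_poly nN.
rewrite coef_poly nN -mulrA coefXM /= coefM nc_sumS big_ord_recr /= addrC.
rewrite subnn coefD coefC coef_poly ltnW // /= coef_poly (leq_ltn_trans _ nN) //.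
rewrite addr0 [X in _ = X + _]mulrC; congr (_ + _); apply: eq_bigr => i _.
have im := ltn_ord i; rewrite coefD coefC !coef_poly.
have -> : (i < N)%N by lia.
have -> : (n - i < N)%N by lia.
have -> : (n - i)%N = (n - i).-1.+1 by lia.
by rewrite add0r.
Qed.

Lemma nc_series_tail : eqX N nc_series (1 + tail 0).
Proof.
by move=> [|n] nN; rewrite coefD coef1 !coef_poly nN /= ?addr0 ?add0r.
Qed.

(** Unrolling the recursion in the mark: after [j] steps the first block has
    either been closed, with some size s at most [j], or still has w^j in front. *)
Lemma tail_expand j :
  eqX N (tail 0) (\sum_(1 <= s < j.+1) u s *: w ^+ s + w ^+ j * tail j).
Proof.
elim: j => [|j ih]; first by rewrite big_geq // add0r expr0 mul1r.
rewrite ih [in X in eqX _ _ X]big_nat_recr //= {1}(tail_rec j) -addrA.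
rewrite -mul_polyC.
rewrite (_ : w ^+ j * _ = (u j.+1)%:P * w ^+ j.+1 + w ^+ j.+1 * tail j.+1) //.
by rewrite exprS; ring.
Qed.

Lemma pos_series_comp (v : {poly A}) :
  pos_series N u \Po v = \sum_(1 <= s < N) u s *: v ^+ s.
Proof.
rewrite comp_poly_lincomb.
rewrite -(big_mkord predT (fun s => (if s is 0%N then 0 else u s) *: v ^+ s)).
case: (posnP N) => [->|N0]; first by rewrite !big_geq.
rewrite big_ltn //= scale0r add0r big_nat_cond [RHS]big_nat_cond.
by apply: eq_bigr => -[].
Qed.

(** The relation M(z) = 1 + R(z M(z)) between moments and free cumulants. The
    remainder of [tail_expand] vanishes modulo X^N because w has no constant term. *)
Lemma functional_equation :
  eqX N nc_series (1 + (pos_series N u \Po w)).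
Proof.
rewrite nc_series_tail; case: (posnP N) => [N0|N0].
  by move=> i; rewrite N0.
rewrite (tail_expand N.-1) pos_series_comp prednK //.
have -> : eqX N (w ^+ N.-1 * tail N.-1) 0.
  have := @coef0_exp_eqX _ N.-1 w; rewrite coefXM => /(_ erefl) h.
  have t0 : (tail N.-1)`_0 = 0 by rewrite coef_poly N0.
  by have := eqX_shift t0 h; rewrite prednK // mulr0 mulrC; exact.
by rewrite addr0.
Qed.

Lemma deriv_pos_series_comp (v : {poly A}) :
  (pos_series N u)^`() \Po v = \sum_(1 <= s < N) u s *: (v ^+ s.-1 *+ s).
Proof.
rewrite /pos_series poly_def.
rewrite -(big_mkord predT (fun s => (if s is 0%N then 0 else u s) *: 'X^s)).
rewrite raddf_sum /= linear_sum /=.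
case: (posnP N) => [->|N0]; first by rewrite !big_geq.
rewrite big_ltn //= scale0r linear0 linear0 add0r.
rewrite big_nat_cond [RHS]big_nat_cond.
apply: eq_bigr => -[//|s] _.
by rewrite derivZ derivXn comp_polyZ linearMn /= comp_Xn_poly.
Qed.

End FunctionalEquation.

Section Infinitesimal.
Variables (R : comNzRingType) (r delta : nat -> R) (N : nat).

Let c0 (P : {poly {poly R}}) : {poly R} := map_poly (coefp 0) P.
Let c1 (P : {poly {poly R}}) : {poly R} := map_poly (coefp 1) P.

Let c0E P i : (c0 P)`_i = P`_i`_0.
Proof. by rewrite coef_map_id0 // /= coef0. Qed.
Let c1E P i : (c1 P)`_i = P`_i`_1.
Proof. by rewrite coef_map_id0 // /= coef0. Qed.

Let c0M P Q : c0 (P * Q) = c0 P * c0 Q.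
Proof.
apply/polyP => i; rewrite c0E !coefM coef_sum; apply: eq_bigr => j _.
by rewrite coefM big_ord1 !c0E.
Qed.

Let c1M P Q : c1 (P * Q) = c0 P * c1 Q + c1 P * c0 Q.
Proof.
apply/polyP => i; rewrite c1E coefD !coefM coef_sum -big_split /=.
apply: eq_bigr => j _.
by rewrite coefM !big_ord_recl big_ord0 addr0 !c0E !c1E.
Qed.

Let c0_exp P n : c0 (P ^+ n) = c0 P ^+ n.
Proof.
elim: n => [|n ih]; last by rewrite !exprS c0M ih.
by apply/polyP => i; rewrite c0E !expr0 !coef1; case: eqP; rewrite ?coef1 ?coef0.
Qed.

Let c1_exp P n : c1 (P ^+ n) = c0 P ^+ n.-1 * c1 P *+ n.
Proof.
elim: n => [|n ih].
  by apply/polyP => i; rewrite c1E !expr0 mulr0n coef1 coef0;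
    case: eqP; rewrite ?coef1 ?coef0.
rewrite exprS c1M ih c0_exp mulrnAr mulrA -exprS /=.
case: n {ih} => [|n]; first by rewrite mulr0n add0r mulr1n mulrC.
by rewrite [RHS]mulrSr [_ * c1 P]mulrC [c1 P * _]mulrC mulrC.
Qed.

Let u s : {poly R} := (r s)%:P + delta s *: 'X.
Let u0 s : (u s)`_0 = r s.
Proof. by rewrite coefD coefC coefZ coefX mulr0 addr0. Qed.
Let u1 s : (u s)`_1 = delta s.
Proof. by rewrite coefD coefC coefZ coefX mulr1 add0r. Qed.

(** The functional equation holds over every commutative ring, in particular for
    the cumulants r + delta t over polynomials in t. Its coefficient of t is the
    derivative in the direction delta. Here [c0] and [c1] extract the coefficients of
    t^0 and t^1; the former is multiplicative and the latter is a derivation over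
    it. *)
Lemma functional_equation_derivative :
  let M := nc_series r N in
  let dM := \poly_(n < N) (nc_sum u 0 n)`_1 in
  eqX N dM ((pos_series N delta \Po ('X * M)) +
            ((pos_series N r)^`() \Po ('X * M)) * ('X * dM)).
Proof.
move=> M dM.
have hM : c0 (nc_series u N) = M.
  apply/polyP => i; rewrite c0E !coef_poly; case: ifP => // _; last by rewrite coef0.
  rewrite -!NC_sumE coef_sum; apply: eq_bigr => pi _.
  elim/big_rec2: _ => [|V x y _ ih]; first by rewrite coef1.
  by rewrite coefM big_ord1 ih u0.
have hdM : c1 (nc_series u N) = dM.
  by apply/polyP => i; rewrite c1E !coef_poly; case: ifP => // _; rewrite coef0.
have cX0 : c0 'X = 'X.
  by apply/polyP => i; rewrite c0E !coefX; case: eqP; rewrite ?coef1 ?coef0.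
have cX1 : c1 'X = 0.
  by apply/polyP => i; rewrite c1E !coefX coef0; case: eqP; rewrite ?coef1 ?coef0.
have hw0 : c0 ('X * nc_series u N) = 'X * M by rewrite c0M cX0 hM.
have hw1 : c1 ('X * nc_series u N) = 'X * dM.
  by rewrite c1M cX0 cX1 hdM mul0r addr0.
have := @functional_equation _ u N.
set w := 'X * nc_series u N in hw0 hw1 *; set v := 'X * M => fe.
have {}fe : eqX N dM (c1 (1 + (pos_series N u \Po w))).
  by move=> i iN; rewrite -hdM !c1E fe.
apply: (eqX_trans fe); rewrite !pos_series_comp deriv_pos_series_comp.
have -> : c1 (1 + \sum_(1 <= s < N) u s *: w ^+ s) =
    \sum_(1 <= s < N) c1 (u s *: w ^+ s).
  apply/polyP => i; rewrite c1E coefD coefD coef1 coef_sum !coef_sum.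
  have -> : ((i == 0%N)%:R : {poly R})`_1 = 0.
    by case: eqP; rewrite ?coef1 ?coef0.
  by rewrite add0r; apply: eq_bigr => s _; rewrite c1E.
rewrite mulr_suml -big_split /=; apply: eqX_sum => s _.
apply/eqX_sub; rewrite (_ : _ - _ = 0) //; apply/eqP; rewrite subr_eq0; apply/eqP.
rewrite -[u s *: _]mul_polyC c1M.
have -> : c0 (u s)%:P = (r s)%:P.
  by apply/polyP => i; rewrite c0E !coefC; case: eqP => _; rewrite ?u0 ?coef0.
have -> : c1 (u s)%:P = (delta s)%:P.
  by apply/polyP => i; rewrite c1E !coefC; case: eqP => _; rewrite ?u1 ?coef0.
rewrite c1_exp c0_exp hw0 hw1 -!mul_polyC; ring.
Qed.

End Infinitesimal.

(** * Partitions whose Kreweras complement has one nontrivial block *)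

Section NextEnum.
Variable n : nat.
Implicit Types (V : {set 'I_n}) (x y z : 'I_n).

Lemma enum_set_sorted V : sorted (fun x y : 'I_n => (x < y)%N) (enum V).
Proof.
have : sorted ltn (map val (enum 'I_n)) by rewrite val_enum_ord iota_ltn_sorted.
rewrite sorted_map => /(sorted_filter _) h; rewrite enumT in h.
rewrite {1}/enum_mem; apply: h => x y z /=; exact: ltn_trans.
Qed.

(** The successor in the increasing list of [V], characterised by cyclic order. *)
Lemma next_enumP V x : x \in V ->
  let y := next (enum V) x in
  y \in V /\ forall z, z \in V -> if (x < y)%N then (z <= x)%N || (y <= z)%N
                                  else (y <= z <= x)%N.
Proof.
move=> xV /=; have xs : x \in enum V by rewrite mem_enum.
split; first by rewrite -mem_enum mem_next.
move=> z; rewrite -mem_enum => zs.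
have st := enum_set_sorted V; set s := enum V in xs zs st *.
have tr : transitive (fun x y : 'I_n => (x < y)%N) by move=> a b c; apply: ltn_trans.
have mono i j : (i < size s)%N -> (j < size s)%N ->
    (nth x s i < nth x s j)%N = (i < j)%N.
  move=> iS jS; apply/idP/idP => [|ij]; last exact: (sorted_ltn_nth tr x st).
  apply: contraTT; rewrite -!leqNgt leq_eqVlt => /orP[/eqP->//|ji].
  by apply: ltnW; apply: (sorted_ltn_nth tr x st).
have iS : (index x s < size s)%N by rewrite index_mem.
have jS : (index z s < size s)%N by rewrite index_mem.
have mono' i j : (i < size s)%N -> (j < size s)%N ->
    (nth x s i <= nth x s j)%N = (i <= j)%N.
  by move=> ? ?; rewrite leqNgt mono // -leqNgt.
have Ex := nth_index x xs; have Ez := nth_index x zs.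
have -> : next s x = nth x s (if ((index x s).+1 < size s)%N then (index x s).+1 else 0).
  rewrite next_nth xs; move: (index x s) iS => i.
  case: (s) => [//|y s'] /=; rewrite ltnS => iS.
  rewrite ltnS; case: ifP => [lt|/negbT]; first by rewrite (set_nth_default x).
  by rewrite -leqNgt => ge; rewrite nth_default.
set k := if ((index x s).+1 < size s)%N then _ else _.
have kS : (k < size s)%N by rewrite /k; case: ifP => // _; apply: leq_ltn_trans iS.
have -> : (x < nth x s k)%N = (index x s < k)%N by rewrite -[RHS]mono // Ex.
have -> : (nth x s k <= z)%N = (k <= index z s)%N by rewrite -[RHS]mono' // Ez.
have -> : (z <= x)%N = (index z s <= index x s)%N by rewrite -[RHS]mono' // Ez Ex.
rewrite /k; move: iS jS; clear.
case: (ltnP (index x s).+1 (size s)) => hS iS jS; last by rewrite ltn0; lia.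
by rewrite ltnSn; lia.
Qed.

End NextEnum.

Section Cyclic.
Variable n : nat.
Implicit Types (pi : {set {set 'I_n}}) (V W : {set 'I_n}) (x y z : 'I_n).

Definition rank_below W (i : nat) : nat := #|[set w in W | (w < i)%N]|.

(** The numbering modulo #|W| of the cyclic intervals that end at the points of
    W: the points after the last element of W belong to the interval of the first
    one. *)
Definition cyc_index W (x : 'I_n) : nat := (rank_below W x %% #|W|)%N.

Definition cyclic_intervals W : {set {set 'I_n}} :=
  preim_partition (cyc_index W) [set: 'I_n].

Definition one_nontrivial_block W : {set {set 'I_n}} :=
  W |: [set [set x] | x in ~: W].

Lemma rank_below_le W i : (rank_below W i <= #|W|)%N.
Proof. by apply/subset_leq_card/subsetP => x; rewrite inE => /andP[]. Qed.

Lemma rank_below_mono W i j : (i <= j)%N -> (rank_below W i <= rank_below W j)%N.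
Proof.
move=> ij; apply/subset_leq_card/subsetP => x; rewrite !inE => /andP[-> xi] /=.
exact: leq_trans xi ij.
Qed.

Lemma rank_belowS W x : rank_below W x.+1 = (rank_below W x + (x \in W))%N.
Proof.
rewrite /rank_below; case: (boolP (x \in W)) => xW.
  rewrite (_ : [set w in W | _] = x |: [set w in W | (w < x)%N]).
    by rewrite cardsU1 inE xW ltnn /= addnC.
  apply/setP => y; rewrite !inE ltnS leq_eqVlt.
  by have [->|yx] := eqVneq y x; rewrite ?xW ?eqxx //= (inj_eq val_inj) (negbTE yx).
rewrite addn0; apply: eq_card => y; rewrite !inE ltnS leq_eqVlt.
have [->|yx] := eqVneq y x; first by rewrite (negbTE xW).
by rewrite (inj_eq val_inj) (negbTE yx).
Qed.

Lemma rank_below0 W : rank_below W 0 = 0%N.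
Proof. by apply: eq_card0 => x; rewrite !inE ltn0 andbF. Qed.

Lemma rank_below_n W : rank_below W n = #|W|.
Proof. by apply: eq_card => x; rewrite !inE ltn_ord andbT. Qed.

Lemma rank_below_lt W x : x \in W -> (rank_below W x < #|W|)%N.
Proof.
move=> xW; have := rank_belowS W x; rewrite xW => E.
by have := rank_below_le W x.+1; ord_lia.
Qed.

Lemma rank_below_inj W : {in W &, injective (fun x => rank_below W x)}.
Proof.
move=> x y xW yW E; apply: contraTeq isT => xy.
wlog lt : x y xW yW E xy / (x < y)%N => [th|].
  have [lt|lt|/val_inj xy'] := ltngtP x y; first exact: (th x y).
    by apply: (th y x) => //; rewrite eq_sym.
  by rewrite xy' eqxx in xy.
have := rank_below_mono W lt; rewrite rank_belowS xW; ord_lia.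
Qed.

Lemma cyc_index_in W x : x \in W -> cyc_index W x = rank_below W x.
Proof. by move=> xW; rewrite /cyc_index modn_small // rank_below_lt. Qed.

Lemma cyc_index_inj W : {in W &, injective (cyc_index W)}.
Proof.
by move=> x y xW yW; rewrite !cyc_index_in //; apply: rank_below_inj.
Qed.

Lemma cyc_index_succ W x :
  cyc_index W (ordS x) = ((cyc_index W x + (x \in W)) %% #|W|)%N.
Proof.
rewrite /cyc_index modnDml -rank_belowS /=.
have xn := ltn_ord x; have [lt|ge] := ltnP x.+1 n; first by rewrite (modn_small lt).
have E : x.+1 = n by lia.
by rewrite E modnn rank_below0 mod0n rank_below_n modnn.
Qed.

Lemma mem_cyclic_intervals W : partition (cyclic_intervals W) [set: 'I_n].
Proof. exact: preim_partitionP. Qed.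

Lemma pblock_cyclic_intervals W x y :
  (y \in pblock (cyclic_intervals W) x) = (cyc_index W x == cyc_index W y).
Proof.
rewrite /cyclic_intervals /preim_partition pblock_equivalence_partition ?inE //.
by split=> // /eqP->.
Qed.

Lemma iter_ordS_reach x y : exists m, iter m (@ordS n) x = y.
Proof.
have it m : val (iter m (@ordS n) x) = ((x + m) %% n)%N.
  elim: m => [|m ih]; first by rewrite addn0 modn_small.
  by rewrite iterS /= ih -addn1 modnDml addn1 addnS.
have xn := ltn_ord x; have yn := ltn_ord y.
exists (n - x + y)%N; apply: val_inj; rewrite it.
have -> : (x + (n - x + y) = n + y)%N by lia.
by rewrite modnDl modn_small.
Qed.

(** Walking upwards from any point reaches a point of [W] without leaving the
    cyclic interval; the relation [R] records what is preserved at each step. *)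
Lemma cyc_interval_end W (R : rel 'I_n) : W != set0 -> transitive R -> reflexive R ->
  (forall x, x \notin W -> R x (ordS x)) ->
  forall x, exists w, [/\ w \in W, R x w & cyc_index W x = cyc_index W w].
Proof.
move=> /set0Pn[w0 w0W] tr rf st x; have [m] := iter_ordS_reach x w0.
elim: m x => [|m ih] x.
  by move=> /= ->; exists w0; split.
rewrite iterSr => /ih[w [wW Rw Ew]].
case: (boolP (x \in W)) => xW; first by exists x; split.
exists w; split=> //; first exact: tr (st x xW) Rw.
by rewrite -Ew cyc_index_succ (negbTE xW) addn0 modn_mod.
Qed.

Section KrewerasPermutation.
Variable pi : {set {set 'I_n}}.
Hypothesis P : pi \in NC n.

Let part : partition pi [set: 'I_n]. Proof. by move: P; rewrite inE => /andP[]. Qed.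
Let nc : noncrossing pi. Proof. by move: P; rewrite inE => /andP[]. Qed.
Let ncpi := proj2 (noncrossingP pi) nc.
Let tri : trivIset pi := partition_trivIset part.
Let b := block_perm pi.
Let rho := (@long_cycle n * b^-1)%g.

Let blk x : pblock pi x \in pi /\ x \in pblock pi x.
Proof. by apply: partition_block part _; rewrite inE. Qed.

Lemma same_block_sym x y : (y \in pblock pi x) = (x \in pblock pi y).
Proof.
apply/idP/idP => h; first by rewrite (same_pblock tri h); have [] := blk x.
by rewrite (same_pblock tri h); have [] := blk y.
Qed.

Lemma same_block_trans y x z :
  y \in pblock pi x -> z \in pblock pi y -> z \in pblock pi x.
Proof. by move=> h; rewrite (same_pblock tri h). Qed.

Lemma block_perm_next x :
  b x \in pblock pi x /\ forall z, z \in pblock pi x ->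
    if (x < b x)%N then (z <= x)%N || (b x <= z)%N else (b x <= z <= x)%N.
Proof.
by rewrite /b block_permE //; apply: next_enumP; have [] := blk x.
Qed.

Lemma krewerasE x : b (rho x) = ordS x.
Proof. by rewrite /rho permM permKV permE. Qed.

Lemma kreweras_block x : rho x \in pblock pi (ordS x).
Proof. by rewrite same_block_sym -krewerasE; have [] := block_perm_next (rho x). Qed.

Lemma porbit_stable (S : {set 'I_n}) w : w \in S ->
  (forall x, x \in S -> rho x \in S) -> porbit rho w \subset S.
Proof.
move=> wS st; apply/subsetP => x /porbitP[m ->]; elim: m => [|m ih].
  by rewrite expg0 perm1.
by rewrite expgSr permM st.
Qed.

(** Let [j] be the successor of [w] in its block. The points from [w] to j - 1 are
    stable under the permutation that defines the Kreweras complement: for such a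
    point x, either x + 1 = j and the image of x is [w], or the block of x + 1, which
    cannot cross that of [w], lies strictly between [w] and [j]. A later point of the
    block of [w] is thus never reached. *)
Lemma kreweras_interval w z : z \in pblock pi w -> (w < z)%N ->
  z \notin porbit rho w.
Proof.
move=> zV wz; have [jV hj] := block_perm_next w; set j := b w in jV hj.
have [Vp wV] := blk w.
have wj : (w < j)%N.
  by have := hj z zV; case: ltnP => // jw; ord_lia.
have jz : (j <= z)%N by have := hj z zV; rewrite wj; ord_lia.
rewrite wj in hj.
suff /subsetP s : porbit rho w \subset [set x : 'I_n | (w <= x < j)%N].
  by apply/negP => /s; rewrite inE; ord_lia.
apply: porbit_stable => [|x]; rewrite ?inE; first by ord_lia.
move=> xj; have cx : ordS x = x.+1 :> nat.
  by rewrite /= modn_small //; have := ltn_ord j; lia.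
have [E|xj'] := eqVneq (x.+1) j.
  have -> : rho x = w.
    apply: (@perm_inj _ b); rewrite krewerasE; apply: val_inj.
    by rewrite [LHS]cx E.
  by rewrite leqnn wj.
set y := ordS x in cx.
have yj : (w < y < j)%N.
  by rewrite cx; move: xj' xj => /eqP; lia.
have yV : y \notin pblock pi w by apply/negP => /hj; ord_lia.
have := kreweras_block x; rewrite -/y; set t := rho x => ty.
have [Vy yy] := blk y.
have VV : pblock pi y <> pblock pi w by move=> E; rewrite -E yy in yV.
have tw : t != w.
  by apply/eqP => tw; apply: VV; rewrite -(same_pblock tri ty) tw.
have tj : t != j.
  apply/eqP => tj; apply: VV.
  by rewrite -(same_pblock tri ty) tj (same_pblock tri jV).
have /eqP tw' : val t != val w by [].
have /eqP tj' : val t != val j by [].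
apply/andP; split.
  rewrite leqNgt; apply/negP => tlt; apply: VV.
  by apply: (ncpi Vy Vp ty wV yy jV); ord_lia.
rewrite ltnNge; apply/negP => jt; apply: VV; apply/esym.
by apply: (ncpi Vp Vy wV yy jV ty); move: tw' tj' => /=; ord_lia.
Qed.

End KrewerasPermutation.

Section KrewerasInverse.
Variable W : {set 'I_n}.
Hypothesis W0 : W != set0.

Let k0 : (0 < #|W|)%N. Proof. by rewrite card_gt0. Qed.

Lemma same_relation_partition (pi pi' : {set {set 'I_n}}) :
  partition pi [set: 'I_n] -> partition pi' [set: 'I_n] ->
  (forall x y, (y \in pblock pi x) = (y \in pblock pi' x)) -> pi = pi'.
Proof.
move=> P P' E; rewrite -(equivalence_partition_pblock P).
rewrite -(equivalence_partition_pblock P').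
by apply: eq_imset => x; apply/setP => y; rewrite !inE E.
Qed.

Lemma porbit_notin pi x : Kr pi = one_nontrivial_block W -> x \notin W ->
  porbit (@long_cycle n * (block_perm pi)^-1)%g x = [set x].
Proof.
move=> KE xW; set rho := (_ * _)%g.
have : porbit rho x \in one_nontrivial_block W by rewrite -KE; apply: imset_f.
have := porbit_id rho x => xo; rewrite !inE => /orP[/eqP E|/imsetP[y _ E]].
  by rewrite E (negbTE xW) in xo.
by move: xo; rewrite E inE => /eqP ->.
Qed.

Lemma porbit_in pi x : Kr pi = one_nontrivial_block W -> x \in W ->
  porbit (@long_cycle n * (block_perm pi)^-1)%g x = W.
Proof.
move=> KE xW; set rho := (_ * _)%g.
have : porbit rho x \in one_nontrivial_block W by rewrite -KE; apply: imset_f.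
have := porbit_id rho x => xo; rewrite !inE => /orP[/eqP //|/imsetP[y yW E]].
by move: xo yW; rewrite E !inE => /eqP <-; rewrite xW.
Qed.

(** Outside [W] the block successor of x is x + 1, so that the blocks are unions
    of cyclic intervals. Two of these never share a block, by [kreweras_interval]: their
    ends lie in [W], which is a single orbit. *)
Lemma Kr_one_nontrivial pi : pi \in NC n -> Kr pi = one_nontrivial_block W ->
  pi = cyclic_intervals W.
Proof.
move=> P KE; have part : partition pi [set: 'I_n] by move: P; rewrite inE => /andP[].
apply: (same_relation_partition part (mem_cyclic_intervals W)) => x y.
rewrite pblock_cyclic_intervals.
have fix_out z : z \notin W -> ordS z \in pblock pi z.
  move=> zW; rewrite -(krewerasE pi z).
  have := mem_porbit (@long_cycle n * (block_perm pi)^-1)%g 1 z; rewrite expg1.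
  rewrite porbit_notin // inE => /eqP ->.
  by have [] := block_perm_next P z.
have sep w w' : w \in W -> w' \in W -> w' \in pblock pi w -> w = w'.
  wlog lt : w w' / (w < w')%N => [th wW wW' h|].
    have [lt|lt|/val_inj//] := ltngtP w w'; first exact: th.
    by apply/esym; apply: th => //; rewrite same_block_sym.
  move=> wW wW' h; have := kreweras_interval P h lt.
  by rewrite porbit_in // wW'.
have refl z : z \in pblock pi z.
  by have [] := partition_block part (in_setT z).
have ends := @cyc_interval_end W (fun x y => y \in pblock pi x) W0
  (same_block_trans P) refl fix_out.
have [w [wW xw Ew]] := ends x; have [w' [wW' yw Ew']] := ends y.
rewrite Ew Ew'; apply/idP/eqP => [xy|].
  congr cyc_index; apply: sep => //.
  apply: (@same_block_trans _ P x); first by rewrite same_block_sym.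
  exact: (@same_block_trans _ P y).
move/(cyc_index_inj wW wW') => ww'; subst w'.
by apply: (@same_block_trans _ P w) => //; rewrite same_block_sym.
Qed.

(** The rank is monotone with values from 0 to #|W|, so that two blocks could
    cross only if one of them contained both rank 0 and rank #|W|; but then the
    last point would belong to it too. *)
Lemma cyclic_intervals_NC : cyclic_intervals W \in NC n.
Proof.
have part := mem_cyclic_intervals W.
rewrite inE part; apply/noncrossingP => V V' p q r s Vp Vp' pV qV rV sV pq qr rs.
have tri := partition_trivIset part.
have VE := def_pblock tri Vp pV; have VE' := def_pblock tri Vp' qV.
rewrite -VE -VE'; apply/eqP; rewrite eq_pblock //; last first.
  by rewrite (cover_partition part) inE.
rewrite pblock_cyclic_intervals.
move: rV sV; rewrite -VE -VE' !pblock_cyclic_intervals /cyc_index.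
have l1 := rank_below_mono W (ltnW pq).
have l2 := rank_below_mono W (ltnW qr).
have l3 := rank_below_mono W (ltnW rs).
have l4 := rank_below_le W s.
move: (rank_below W p) (rank_below W q) (rank_below W r) (rank_below W s) l1 l2 l3 l4 k0.
move: #|W| => k; clear=> A B C D l1 l2 l3 l4 k0 /eqP AC /eqP BD.
apply/eqP; have [Ck|Ck] := ltnP C k.
  have Ak : (A < k)%N by lia.
  have AE : A = C by move: AC; rewrite (modn_small Ck) (modn_small Ak).
  by have -> : B = A by lia.
have DC : D = C by lia.
by rewrite AC -DC BD.
Qed.

(** The Kreweras permutation fixes the points outside [W], hence preserves [W],
    and there it moves each end of an interval to the end of the next one. *)
Lemma Kr_cyclic_intervals : Kr (cyclic_intervals W) = one_nontrivial_block W.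
Proof.
have P := cyclic_intervals_NC; have part := mem_cyclic_intervals W.
set pi := cyclic_intervals W in P part *.
rewrite /Kr; set rho := (_ * _)%g.
have fix_out x : x \notin W -> rho x = x.
  move=> xW; apply: (@perm_inj _ (block_perm pi)); rewrite krewerasE //.
  have cV : ordS x \in pblock pi x.
    by rewrite pblock_cyclic_intervals cyc_index_succ (negbTE xW) addn0 modn_mod.
  have [yV hy] := block_perm_next P x; have := hy _ cV.
  set y := block_perm pi x in yV hy *.
  apply: contra_eq => /eqP/eqP; rewrite -(inj_eq val_inj) /=.
  have xn := ltn_ord x; have yn := ltn_ord y.
  have [lt|ge] := ltnP x.+1 n.
    by rewrite modn_small // => /eqP ne; case: ltnP => xy; lia.
  have -> : x.+1 = n by lia.
  by rewrite modnn => /eqP ne; case: ltnP => xy; lia.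
have stab x : x \in W -> rho x \in W.
  move=> xW; apply: contraT => h; have := fix_out _ h => /perm_inj E.
  by rewrite E xW in h.
have idx x : x \in W -> cyc_index W (rho x) = ((cyc_index W x).+1 %% #|W|)%N.
  move=> xW; have := kreweras_block P x; rewrite -/rho pblock_cyclic_intervals.
  by move=> /eqP <-; rewrite cyc_index_succ xW addn1.
have iter_stab m x : x \in W -> (rho ^+ m)%g x \in W /\
    cyc_index W ((rho ^+ m)%g x) = ((cyc_index W x + m) %% #|W|)%N.
  move=> xW; elim: m => [|m [ih1 ih2]].
    by rewrite expg0 perm1 addn0 {2}/cyc_index modn_mod.
  rewrite expgSr permM; split; first exact: stab.
  by rewrite idx // ih2 -addn1 modnDml addn1 addnS.
have orbW x : x \in W -> porbit rho x = W.
  move=> xW; apply/setP => y; apply/idP/idP => [/porbitP[m ->]|yW].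
    by have [] := iter_stab m x xW.
  pose m := (#|W| - cyc_index W x + cyc_index W y)%N.
  have [mW mE] := iter_stab m x xW.
  suff -> : y = (rho ^+ m)%g x by exact: mem_porbit.
  apply: (cyc_index_inj yW mW); rewrite mE /m.
  have xk : (cyc_index W x < #|W|)%N by rewrite ltn_mod.
  rewrite addnA subnKC ?modnDl //; last exact: ltnW.
  by rewrite /cyc_index modn_mod.
have orb1 x : x \notin W -> porbit rho x = [set x].
  move=> xW; apply/setP => y; rewrite inE; apply/porbitP/eqP => [[m ->]|->].
    by elim: m => [|m ih]; rewrite ?expg0 ?perm1 // expgSr permM ih fix_out.
  by exists 0%N; rewrite expg0 perm1.
apply/setP => V; rewrite !inE; apply/imsetP/orP => [[x _ ->]|[/eqP->|/imsetP[x]]].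
- case: (boolP (x \in W)) => xW; first by left; rewrite orbW.
  by right; apply/imsetP; exists x; rewrite ?inE // orb1.
- by have /set0Pn[w wW] := W0; exists w; rewrite ?orbW.
- by rewrite inE => xW ->; exists x; rewrite ?orb1.
Qed.

Lemma Kr_cyclic_intervalsP pi : pi \in NC n ->
  (Kr pi == one_nontrivial_block W) = (pi == cyclic_intervals W).
Proof.
move=> P; apply/eqP/eqP => [|->]; first exact: Kr_one_nontrivial.
exact: Kr_cyclic_intervals.
Qed.

End KrewerasInverse.
End Cyclic.

(** * Kreweras complements weighted by the cumulants of a point mass *)

Section PointMassCumulants.
Variables (R : realType) (c e : nat -> R) (n : nat).
Hypotheses (e1 : e 1 = 1) (e_other : forall s, (1 < s)%N -> e s = 0).
Implicit Types (pi : {set {set 'I_n}}) (V W : {set 'I_n}).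

Lemma one_nontrivial_blockP pi V : partition pi [set: 'I_n] -> V \in pi ->
  [forall U in pi :\ V, #|U| == 1%N] = (pi == one_nontrivial_block V).
Proof.
move=> P Vp; apply/forall_inP/eqP => [h|-> U]; last first.
  rewrite !inE => /andP[UV /orP[/eqP UE|/imsetP[x _ ->]]]; last by rewrite cards1.
  by rewrite UE eqxx in UV.
apply/setP => U; rewrite !inE; apply/idP/orP => [Up|].
  have [->|UV] := eqVneq U V; [by left|right].
  have /cards1P[x UE] : #|U| == 1%N by apply: h; rewrite !inE UV.
  apply/imsetP; exists x => //; rewrite inE; apply: contra UV => xV.
  by apply/eqP; apply: (partition_same P Up Vp _ xV); rewrite UE set11.
case=> [/eqP-> //|/imsetP[x]]; rewrite inE => xV ->.
have [Bp xB] := partition_block P (in_setT x).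
have BV : pblock pi x != V by apply: contra xV => /eqP <-.
have /cards1P[y BE] : #|pblock pi x| == 1%N by apply: h; rewrite !inE BV.
by move: xB; rewrite BE inE => /eqP ->; rewrite -BE.
Qed.

(** The cumulants [e] of the point mass at 1 vanish beyond order 1, so only the
    partitions with at most one block of size above 1 survive. The sum over W accounts
    for the discrete partition, in which every singleton can play the role of W. *)
Lemma dpart_point_mass pi : partition pi [set: 'I_n] ->
  dpart c e pi = \sum_(W | (W != set0) && (pi == one_nontrivial_block W)) c #|W|.
Proof.
move=> P; transitivity
  (\sum_(V in pi) c #|V| * (pi == one_nontrivial_block V)%:R).
  apply: eq_bigr => V Vp; congr (_ * _); rewrite -one_nontrivial_blockP //.
  case: (boolP [forall U in _, _]) => [/forall_inP h|].
    by rewrite /upart big1 // => U /h/eqP ->.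
  rewrite negb_forall_in => /existsP[U /andP[UV U1]].
  rewrite /upart (bigD1 U) //= e_other ?mul0r ?mulr0 //.
  have : U != set0.
    by apply: contraTneq UV => ->; rewrite !inE (partition0 P) andbF.
  by move: U1; rewrite -card_gt0; case: #|U| => [|[|]].
rewrite [LHS]big_mkcond [RHS]big_mkcond; apply: eq_bigr => W _.
case: (boolP (pi == _)) => [/eqP E|NE]; last first.
  by rewrite mulr0 andbF if_same.
rewrite andbT mulr1; have -> : W \in pi by rewrite E !inE eqxx.
have -> // : W != set0.
by apply/eqP => W0; have := partition0 P; rewrite {1}E W0 !inE eqxx.
Qed.

Lemma one_nontrivial_block_NC W : W != set0 -> one_nontrivial_block W \in NC n.
Proof.
move=> W0; rewrite inE; apply/andP; split.
  apply: partition_pointwise.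
  - move=> x _; case: (boolP (x \in W)) => xW; first by exists W; rewrite ?inE ?eqxx.
    exists [set x]; rewrite ?set11 // !inE; apply/orP; right.
    by apply: imset_f; rewrite inE.
  - by move=> B _; apply: subsetT.
  - rewrite !inE negb_or eq_sym W0 /=; apply/imsetP => -[x _ /setP/(_ x)].
    by rewrite !inE eqxx.
  - move=> B C x; rewrite !inE.
    case/orP => [/eqP->|/imsetP[y yW ->]]; case/orP => [/eqP->|/imsetP[z zW ->]] //.
    + by rewrite inE => xW /eqP xz; rewrite inE -xz xW in zW.
    + by rewrite inE => /eqP xy xW; rewrite inE -xy xW in yW.
    + by rewrite !inE => /eqP -> /eqP ->.
apply/noncrossingP => B C p q r s.
rewrite !inE => /orP[/eqP->|/imsetP[y _ ->]] /orP[/eqP->|/imsetP[z _ ->]] //.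
- by rewrite !inE => _ /eqP-> _ /eqP->; ord_lia.
- by rewrite !inE => /eqP-> _ /eqP->; ord_lia.
- by rewrite !inE => /eqP-> _ /eqP->; ord_lia.
Qed.

Lemma one_nontrivial_block_sum_NC :
  \sum_(pi in NC n) dpart c e pi = \sum_(1 <= k < n.+1) c k *+ 'C(n, k).
Proof.
rewrite (eq_bigr (fun pi => \sum_(W | (W != set0) && (pi == one_nontrivial_block W))
  c #|W|)); last by move=> pi; rewrite inE => /andP[P _]; apply: dpart_point_mass.
rewrite (exchange_big_dep (fun W => W != set0)) /=; last by move=> pi W _ /andP[].
rewrite (eq_bigr (fun W => c #|W|)); last first.
  move=> W W0; rewrite (big_pred1 (one_nontrivial_block W)) // => pi.
  rewrite W0 /=; case: eqP => [->|_]; last by rewrite andbF.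
  by rewrite one_nontrivial_block_NC.
rewrite (partition_big (fun W : {set 'I_n} => inord #|W| : 'I_n.+1) (fun k : 'I_n.+1 => (0 < k)%N)) /=; last first.
  by move=> W W0; rewrite inordK ?card_gt0 // ltnS -[X in (_ <= X)%N]card_ord max_card.
rewrite (eq_bigr (fun k : 'I_n.+1 => c k *+ 'C(n, k))).
  rewrite -(big_mkord (fun k => 0 < k)%N (fun k => c k *+ 'C(n, k))).
  rewrite big_ltn_cond // ltnn big_nat_cond [RHS]big_nat_cond.
  by apply: eq_bigl => k; rewrite andbT; lia.
move=> k k0; rewrite (eq_bigl (fun W : {set 'I_n} => #|W| == k)).
  rewrite (eq_bigr (fun=> c k)); last by move=> W /eqP->.
  by rewrite sumr_const -cardsE card_draws card_ord.
move=> W; rewrite -(inj_eq (@ord_inj n.+1)) inordK; last first.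
  by rewrite ltnS -[X in (_ <= X)%N]card_ord max_card.
by have [->|] := eqVneq W set0; first by rewrite cards0; move: k0 => /=; case: (val k).
Qed.

Lemma Kr_partition pi : partition (Kr pi) [set: 'I_n].
Proof.
rewrite /Kr; set rho := (_ * _)%g; apply: partition_pointwise => //.
- by move=> x _; exists (porbit rho x); [apply: imset_f | apply: porbit_id].
- by apply/imsetP => -[x _ /setP/(_ x)]; rewrite porbit_id inE.
- move=> B C x /imsetP[y _ ->] /imsetP[z _ ->].
  by rewrite -!eq_porbit_mem => /eqP-> /eqP->.
Qed.

Lemma Kr_point_mass_sum (r : nat -> R) :
  \sum_(pi in NC n) upart r pi * dpart c e (Kr pi) =
  \sum_(W : {set 'I_n} | W != set0) c #|W| * upart r (cyclic_intervals W).
Proof.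
rewrite (eq_bigr (fun pi => \sum_(W | (W != set0) && (Kr pi == one_nontrivial_block W))
  c #|W| * upart r pi)); last first.
  move=> pi _; rewrite dpart_point_mass ?Kr_partition // mulr_sumr.
  by apply: eq_bigr => W _; rewrite mulrC.
rewrite (exchange_big_dep (fun W => W != set0)) /=; last by move=> pi W _ /andP[].
apply: eq_bigr => W W0; rewrite (big_pred1 (cyclic_intervals W)) // => pi.
rewrite W0 /=; case: (boolP (pi \in NC n)) => P /=.
  by rewrite Kr_cyclic_intervalsP.
by apply/esym; apply: contraNF P => /eqP->; apply: cyclic_intervals_NC.
Qed.

Lemma upart_point_mass pi x : partition pi [set: 'I_n] ->
  upart e pi = (pi == one_nontrivial_block [set x])%:R.
Proof.
move=> P; case: (boolP [forall U in pi, #|U| == 1%N]) => [/forall_inP h|].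
  rewrite [LHS]big1; last by move=> U /h/eqP ->.
  have [Bp xB] := partition_block P (in_setT x).
  have /cards1P[y BE] := h _ Bp.
  have xp : [set x] \in pi by move: xB Bp; rewrite BE inE => /eqP->.
  rewrite -one_nontrivial_blockP //.
  by have /forall_inP -> // : forall U, U \in pi :\ [set x] -> #|U| == 1%N
    by move=> U; rewrite inE => /andP[_ /h].
rewrite negb_forall_in => /existsP[U /andP[Up U1]].
rewrite /upart (bigD1 U) //= e_other ?mul0r; last first.
  have : U != set0 by apply: contraTneq Up => ->; rewrite (partition0 P).
  by move: U1; rewrite -card_gt0; case: #|U| => [|[|]].
case: eqP => // E; move: Up U1; rewrite E !inE.
by case/orP => [/eqP->|/imsetP[y _ ->]]; rewrite cards1.
Qed.

(** All blocks of the Kreweras complement are singletons only for the one-block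
    partition, the cyclic intervals of a single point. *)
Lemma Kr_point_mass_upart (f : {set {set 'I_n}} -> R) : (0 < n)%N ->
  \sum_(pi in NC n) f pi * upart e (Kr pi) = f [set [set: 'I_n]].
Proof.
move=> n0; pose x0 := Ordinal n0.
have x00 : [set x0] != set0 by apply/set0Pn; exists x0; rewrite inE.
have <- : cyclic_intervals [set x0] = [set [set: 'I_n]].
  have := one_block_NC n0; rewrite inE => /andP[P _].
  apply: (same_relation_partition (mem_cyclic_intervals _) P) => x y.
  rewrite pblock_cyclic_intervals /cyc_index cards1 !modn1 eqxx.
  by rewrite (def_pblock (partition_trivIset P) (set11 _)) inE.
rewrite (eq_bigr (fun pi => if pi == cyclic_intervals [set x0] then f pi else 0)).
  rewrite -big_mkcondr (big_pred1 (cyclic_intervals [set x0])) //= => pi /=.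
  by case: eqP => [->|_]; rewrite ?andbF // cyclic_intervals_NC.
move=> pi P; rewrite (upart_point_mass x0) ?Kr_partition //.
by rewrite Kr_cyclic_intervalsP //; case: eqP; rewrite ?mulr1 ?mulr0.
Qed.

End PointMassCumulants.

(** * Cyclic interval partitions and their generating function *)

Lemma bigmaxn_ltP (I : finType) (P : pred I) (F : I -> nat) i m :
  (\big[maxn/i]_(y | P y) F y < m)%N <->
  (i < m)%N /\ forall y, P y -> (F y < m)%N.
Proof.
split=> [|[im h]]; last first.
  by elim/big_ind: _ => // x y xm ym; rewrite gtn_max xm.
move=> h; split.
  apply: leq_ltn_trans h.
  by elim/big_rec: _ => // y x _ ix; rewrite leq_max ix orbT.
move=> y Py; apply: leq_ltn_trans h.
by rewrite (bigD1 y) //= leq_maxl.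
Qed.

Section BlockSizes.
Variables (n : nat).
Implicit Types (W Z : {set 'I_n}) (x y z a : 'I_n).

Definition after (i : nat) : {set 'I_n} := [set x : 'I_n | (i < x)%N].

(** The greatest element of [Z] below [z], or [i] if there is none; here [Z] lies
    above [i]. *)
Definition pred_in (i : nat) Z (z : nat) : nat :=
  \big[maxn/i]_(y in Z | (y < z)%N) y.

Definition last_in (i : nat) Z : nat := \big[maxn/i]_(y in Z) y.

Lemma card_segment (a b : nat) : (b <= n)%N -> #|segment n a b| = (b - a)%N.
Proof.
elim: b => [|b ih] bn.
  by apply: eq_card0 => x; rewrite !inE; lia.
have [ab|ba] := leqP a b; last first.
  rewrite (_ : _ - _ = 0)%N; last by lia.
  by apply: eq_card0 => x; rewrite !inE; lia.
rewrite (_ : segment n a b.+1 = Ordinal bn |: segment n a b).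
  by rewrite cardsU1 ih ?inE /=; lia.
by apply/setP => x; rewrite !inE -(inj_eq val_inj) /=; lia.
Qed.

Section Blocks.
Variables (a : 'I_n) (Z : {set 'I_n}).
Hypothesis aZ : Z \subset after a.

Let W := a |: Z.
Let k := #|W|.
Let aW : a \in W. Proof. by rewrite !inE eqxx. Qed.
Let ZW z : z \in Z -> z \in W. Proof. by rewrite !inE => ->; rewrite orbT. Qed.
Let az z : z \in Z -> (a < z)%N. Proof. by move/(subsetP aZ); rewrite inE. Qed.
Let WE w : w \in W -> w = a \/ w \in Z.
Proof. by rewrite !inE => /orP[/eqP|]; [left|right]. Qed.

Let rank_a : rank_below W a = 0%N.
Proof.
apply: eq_card0 => x; rewrite inE; apply/negP => /andP[/WE[->|/az]]; ord_lia.
Qed.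

Let rank_step w x : w \in W -> (w < x)%N -> (rank_below W w < rank_below W x)%N.
Proof.
move=> wW wx; have := rank_below_mono W wx; rewrite rank_belowS wW.
by rewrite addn1.
Qed.

Lemma cyc_block_inner z : z \in Z ->
  [set x | cyc_index W x == cyc_index W z] = segment n (pred_in a Z z).+1 z.+1.
Proof.
move=> zZ; apply/setP => x; rewrite !inE (cyc_index_in (ZW zZ)) ltnS.
have zk := rank_below_lt (ZW zZ).
have z0 : (0 < rank_below W z)%N by have := rank_step aW (az zZ); rewrite rank_a.
have -> : (cyc_index W x == rank_below W z) = (rank_below W x == rank_below W z).
  have := rank_below_le W x; rewrite leq_eqVlt /cyc_index => /orP[/eqP->|xk].
    by rewrite modnn; move: z0 zk; lia.
  by rewrite modn_small.
apply/eqP/andP => [E|[+ xz]].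
  split.
    apply/bigmaxn_ltP; split.
      rewrite ltnNge; apply/negP => xa; have := rank_below_mono W xa.
      by rewrite rank_a E; lia.
    move=> y /andP[yZ yz]; rewrite ltnNge; apply/negP => xy.
    have := rank_below_mono W xy; have := rank_step (ZW yZ) yz.
    by rewrite E; lia.
  by rewrite leqNgt; apply/negP => /(rank_step (ZW zZ)); rewrite E ltnn.
case/bigmaxn_ltP => ax h; apply: eq_card => w; rewrite !inE.
case: (boolP ((w == a) || (w \in Z))) => //= /orP[/eqP->|wZ].
  by rewrite ax (az zZ).
apply/idP/idP => [wx|wz]; first exact: leq_trans xz.
by apply: h; rewrite wZ.
Qed.

(** The block of the minimum wraps around: it also contains the points beyond the
    last element. *)
Lemma cyc_block_outer :
  [set x | cyc_index W x == cyc_index W a] = ~: segment n a.+1 (last_in a Z).+1.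
Proof.
apply/setP => x; rewrite !inE (cyc_index_in aW) rank_a ltnS negb_and.
rewrite -leqNgt -ltnNge; apply/eqP/orP => [|[xa|]].
- have := rank_below_le W x; rewrite leq_eqVlt /cyc_index => /orP[/eqP E _|xk].
    right; apply/bigmaxn_ltP; split=> [|z zZ]; rewrite ltnNge; apply/negP => xw.
      have := rank_below_mono W xw; have := rank_below_lt aW.
      by rewrite E; lia.
    have := rank_below_mono W xw; have := rank_below_lt (ZW zZ).
    by rewrite E; lia.
  rewrite modn_small // => x0; left; rewrite leqNgt; apply/negP.
  by move/(rank_step aW); rewrite x0.
- have := rank_below_mono W xa; rewrite rank_a leqn0 /cyc_index => /eqP->.
  by rewrite mod0n.
- case/bigmaxn_ltP => ax h; rewrite /cyc_index.
  rewrite (_ : rank_below W x = #|W|) ?modnn //; apply: eq_card => w.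
  rewrite [LHS]inE; case: (boolP (w \in W)) => //= /WE[->//|]; exact: h.
Qed.

Lemma upart_cyclic_intervals (R : realType) (r : nat -> R) :
  upart r (cyclic_intervals W) =
    (\prod_(z in Z) r (z - pred_in a Z z)%N) * r (n - (last_in a Z - a))%N.
Proof.
have part := mem_cyclic_intervals W; have tri := partition_trivIset part.
have W0 : W != set0 by apply/set0Pn; exists a.
have bE x : pblock (cyclic_intervals W) x = [set y | cyc_index W y == cyc_index W x].
  by apply/setP => y; rewrite pblock_cyclic_intervals inE eq_sym.
have -> : cyclic_intervals W = [set pblock (cyclic_intervals W) w | w in W].
  apply/setP => V; apply/idP/imsetP => [Vp|[w _ ->]]; last first.
    by have [] := partition_block part (in_setT w).
  have /set0Pn[x xV] := partition_neq0 part Vp.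
  have [w [wW _ Ew]] := @cyc_interval_end _ W (fun _ _ => true) W0
    (fun _ _ _ _ _ => isT) (fun _ => isT) (fun _ _ => isT) x.
  exists w => //; rewrite -(def_pblock tri Vp xV) !bE.
  by apply/setP => y; rewrite !inE Ew.
rewrite /upart big_imset /=; last first.
  move=> x y xW yW; rewrite !bE => /setP/(_ x); rewrite !inE eqxx.
  by move/esym/eqP/(cyc_index_inj xW yW).
rewrite big_setU1 /=; last by apply/negP => /az; rewrite ltnn.
rewrite mulrC; congr (_ * _).
  apply: eq_bigr => z zZ; rewrite bE cyc_block_inner //; congr r.
  by rewrite [LHS](card_segment _ (ltn_ord z)) subSS.
rewrite bE cyc_block_outer; congr r.
have := cardsC (segment n a.+1 (last_in a Z).+1).
rewrite card_ord card_segment ?subSS; last first.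
  by apply/bigmaxn_ltP; split=> [|y _]; apply: ltn_ord.
by move: #|_| (last_in a Z - a)%N; lia.
Qed.

End Blocks.

Section SumOverSubsets.
Variable A : comNzRingType.

Lemma sum_nonempty_min (D : {set 'I_n}) (f : {set 'I_n} -> A) :
  (forall a, a \in D -> after a \subset D) ->
  \sum_(W : {set 'I_n} | (W \subset D) && (W != set0)) f W =
  \sum_(a in D) \sum_(Z : {set 'I_n} | Z \subset after a) f (a |: Z).
Proof.
move=> Dup.
pose ismin W a := (a \in W) && (W :\ a \subset after a).
have minU W a b : ismin W a -> ismin W b -> a = b.
  move=> /andP[aW ha] /andP[bW hb]; apply: contraTeq isT => ab.
  have := subsetP ha b; rewrite !inE eq_sym ab bW => /(_ isT).
  have := subsetP hb a; rewrite !inE ab aW => /(_ isT); ord_lia.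
have minE W : W != set0 -> exists a, ismin W a.
  case/set0Pn => x0 x0W.
  case: (@arg_minnP _ x0 (fun i => i \in W) (@nat_of_ord n) x0W) => a aW amin.
  exists a; rewrite /ismin aW; apply/subsetP => y; rewrite !inE => /andP[ya yW].
  by rewrite ltn_neqAle amin // andbT eq_sym (inj_eq val_inj).
transitivity (\sum_(W : {set 'I_n} | (W \subset D) && (W != set0))
   \sum_(a | ismin W a) f W).
  apply: eq_bigr => W /andP[_ /minE[a aW]].
  by rewrite (big_pred1 a) // => b; apply/idP/eqP => [/minU/(_ aW)|->].
rewrite (exchange_big_dep (fun a : 'I_n => a \in D)) /=; last first.
  by move=> W a /andP[/subsetP s _] /andP[/s].
apply: eq_bigr => a aD.
rewrite (reindex_onto (fun Z => a |: Z) (fun W => W :\ a)) /=; last first.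
  by move=> W /andP[_ /andP[aW _]]; rewrite setD1K.
apply: eq_bigl => Z.
have aZ : Z \subset after a -> a \notin Z.
  by move=> /subsetP s; apply/negP => /s; rewrite inE ltnn.
apply/idP/idP => [/andP[/andP[_ /andP[_ h]] /eqP E]|Za].
  by rewrite -E.
rewrite setU1K ?aZ // eqxx andbT /ismin setU11 setU1K ?aZ // Za !andbT.
apply/andP; split; last by apply/set0Pn; exists a; rewrite setU11.
by rewrite subUset sub1set aD (subset_trans Za) ?Dup.
Qed.

Variables (r h : nat -> A).

Definition chain_weight (i : nat) Z : A :=
  (\prod_(z in Z) r (z - pred_in i Z z)%N) * h (last_in i Z).

Lemma chain_weight0 i : chain_weight i set0 = h i.
Proof. by rewrite /chain_weight /last_in !big_set0 mul1r. Qed.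

Lemma bigmaxn_idx (I : finType) (P : pred I) (F : I -> nat) i :
  \big[maxn/i]_(y | P y) F y = maxn i (\max_(y | P y) F y).
Proof.
elim/big_rec2: _ => [|y a b _ ->]; first by rewrite maxn0.
by rewrite maxnCA.
Qed.

Lemma chain_weight_cons (i : nat) (a : 'I_n) Z : (i < a)%N -> Z \subset after a ->
  chain_weight i (a |: Z) = r (a - i)%N * chain_weight a Z.
Proof.
move=> ia Za.
have az z : z \in Z -> (a < z)%N by move/(subsetP Za); rewrite inE.
have aZ : a \notin Z by apply/negP => /az; rewrite ltnn.
rewrite /chain_weight big_setU1 //= -mulrA; congr (r _ * _).
  congr (_ - _)%N; rewrite /pred_in big_pred0 // => y; rewrite !inE.
  by case: eqP => [->|_] /=; [rewrite ltnn|case: (boolP (y \in Z)) => //= /az; ord_lia].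
have E (P : pred 'I_n) : P a -> \big[maxn/i]_(y in a |: Z | P y) y =
    \big[maxn/a : nat]_(y in Z | P y) y.
  move=> Pa; rewrite bigmaxn_idx [RHS]bigmaxn_idx (bigD1 a) ?setU11 //=.
  rewrite maxnA; have -> : maxn i a = a by apply/maxn_idPr/ltnW.
  congr maxn; apply: eq_bigl => y; rewrite !inE.
  by have [->|] := eqVneq y a; rewrite ?(negbTE aZ) ?andbF ?andbT.
congr (_ * h _).
  by apply: eq_bigr => z zZ; rewrite /pred_in E ?az.
have := E predT isT; rewrite /last_in.
by under eq_bigl do rewrite andbT; move=> ->; under eq_bigl do rewrite andbT.
Qed.

Variable Rp : {poly A}.
Hypotheses (Rp0 : Rp`_0 = 0) (RpE : forall s, (0 < s < n)%N -> Rp`_s = r s).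

(** Choosing the elements of [Z] one after the other multiplies generating
    series: k steps starting at [a] contribute the coefficients of Rp^k. *)
Lemma chain_sum K (c : nat -> A) (a : 'I_n) : (n - a <= K)%N ->
  \sum_(Z : {set 'I_n} | Z \subset after a) c #|Z| * chain_weight a Z =
  \sum_(l : 'I_n | (a <= l)%N) (\sum_(k < K) c k *: Rp ^+ k)`_(l - a) * h l.
Proof.
elim: K c a => [|K ih] c a naK; first by have := ltn_ord a; lia.
rewrite (bigD1 set0) ?sub0set //= cards0 chain_weight0.
rewrite (@sum_nonempty_min _ (fun Z => c #|Z| * chain_weight a Z)); last first.
  move=> b; rewrite inE => ab; apply/subsetP => x; rewrite !inE.
  exact: ltn_trans.
rewrite [X in _ + X](eq_bigl (fun b : 'I_n => (a < b)%N)); last by move=> b; rewrite inE.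
set P := \sum_(k < K) c k.+1 *: Rp ^+ k.
rewrite [X in _ + X](eq_bigr (fun b : 'I_n =>
   r (b - a)%N * \sum_(l : 'I_n | (b <= l)%N) P`_(l - b) * h l)); last first.
  move=> b ab; rewrite -(ih (fun k => c k.+1)); last by lia.
  rewrite mulr_sumr; apply: eq_bigr => Z Zb.
  rewrite chain_weight_cons // cardsU1.
  have -> : b \notin Z by apply/negP => /(subsetP Zb); rewrite inE ltnn.
  by rewrite add1n; ring.
have -> : \sum_(k < K.+1) c k *: Rp ^+ k = (c 0%N)%:P + Rp * P.
  rewrite big_ord_recl expr0 alg_polyC; congr (_ + _).
  rewrite mulr_sumr; apply: eq_bigr => k _.
  by rewrite exprS scalerAr.
rewrite [RHS](eq_bigr (fun l : 'I_n => (c 0%N)%:P`_(l - a) * h l + (Rp * P)`_(l - a) * h l)); last first.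
  by move=> l _; rewrite coefD mulrDl.
rewrite big_split /=; congr (_ + _).
  rewrite (bigD1 a) //= subnn coefC eqxx big1 ?addr0 // => l /andP[al la].
  rewrite coefC; have /eqP : val l != val a by [].
  by case: eqP; rewrite ?mul0r //=; lia.
under eq_bigr do rewrite mulr_sumr.
rewrite (exchange_big_dep (fun l : 'I_n => (a <= l)%N)) /=; last by move=> b l; lia.
apply: eq_bigr => l al.
under eq_bigr do rewrite mulrA.
rewrite -mulr_suml; congr (_ * _).
rewrite coefM big_ord_recl Rp0 mul0r add0r.
have ln := ltn_ord l.
rewrite -(big_mkord predT (fun j => Rp`_(bump 0 j) * P`_(l - a - bump 0 j))).
rewrite -(big_mkord (fun b => (a < b)%N && (b <= l)%N) (fun b => r (b - a)%N * P`_(l - b))).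
have an := ltn_ord a.
rewrite (@big_cat_nat _ _ _ a.+1) //=.
rewrite [X in X + _]big_nat_cond big1 ?add0r; last by move=> j; lia.
rewrite (@big_cat_nat _ _ _ l.+1) //=.
rewrite [X in _ + X]big_nat_cond [X in _ + X]big1 ?addr0; last by move=> j; lia.
etransitivity; first exact: (big_addn 0 _ a.+1).
rewrite subSS big_nat_cond [RHS]big_nat_cond; apply: eq_big => j; first by lia.
move=> jl; rewrite /bump /= add1n RpE; last by lia.
by congr (r _ * P`_ _); lia.
Qed.

End SumOverSubsets.
End BlockSizes.

Section ConvolutionCumulants.
Variables (R : realType) (c r : nat -> R).

Lemma sum_triangle (F : nat -> R) n :
  \sum_(a < n) \sum_(l < n | (a <= l)%N) F (l - a)%N =
  \sum_(m < n) F m *+ (n - m).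
Proof.
transitivity (\sum_(a < n) \sum_(m < n | (m < n - a)%N) F m).
  apply: eq_bigr => a _.
  rewrite -(big_mkord (fun l => (a <= l)%N) (fun l => F (l - a)%N)).
  rewrite -(big_mkord (fun m => (m < n - a)%N) F).
  have an := ltn_ord a.
  rewrite (@big_cat_nat _ _ _ a) //=; last by lia.
  rewrite [X in X + _]big_nat_cond big1 ?add0r; last by move=> j; lia.
  etransitivity; first exact: (big_addn 0 _ a).
  rewrite -[RHS](big_nat_widen 0 (n - a) n predT) //; last by lia.
  rewrite big_nat_cond [RHS]big_nat_cond; apply: eq_big => j; first by rewrite /= leq_addl.
  by rewrite addnK.
rewrite (exchange_big_dep predT) //=; apply: eq_bigr => m _.
rewrite sumr_const; congr (_ *+ _).
have mn := ltn_ord m.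
rewrite (eq_card (B := segment n 0 (n - m))); last first.
  by move=> a; rewrite !inE; have := ltn_ord a; rewrite unfold_in /=; lia.
by rewrite card_segment; lia.
Qed.

(** Once the minimum [a] and the last element [l] of [W] are fixed, the inner
    intervals form a chain of total length m = l - a and the wrapping block has size
    n - m. There are n - m positions for [a], which turns the generating series Rp of
    the wrapping block into theta Rp. *)
Lemma convolution_cumulants n N : (n < N)%N ->
  let Rp := pos_series N r in
  \sum_(W : {set 'I_n} | W != set0) c #|W| * upart r (cyclic_intervals W) =
  (theta Rp * ((\poly_(k < N) c k.+1) \Po Rp))`_n.
Proof.
move=> nN Rp; rewrite (eq_bigl (fun W : {set 'I_n} => (W \subset setT) && (W != set0)));
  last by move=> W; rewrite subsetT.
rewrite (@sum_nonempty_min _ _ _ (fun W => c #|W| * upart r (cyclic_intervals W)));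
  last by move=> a _; apply: subsetT.
set P := _ \Po _.
transitivity (\sum_(a < n) \sum_(l < n | (a <= l)%N) P`_(l - a) * r (n - (l - a))%N).
  apply: eq_big => [a|a _]; first by rewrite inE.
  have Rp0 : Rp`_0 = 0 by rewrite coef_poly; case: ifP.
  have RpE s : (0 < s < n)%N -> Rp`_s = r s.
    by move=> sn; rewrite coef_poly ifT; [case: s sn|lia].
  have aN : (n - a <= N)%N by lia.
  have := chain_sum (fun l => r (n - (l - a))%N) Rp0 RpE (fun k => c k.+1) aN.
  rewrite -(comp_poly_lincomb N (fun k => c k.+1)) => <-; apply: eq_bigr => Z Za.
  rewrite upart_cyclic_intervals // cardsU1.
  have -> : a \notin Z by apply/negP => /(subsetP Za); rewrite inE ltnn.
  by rewrite add1n.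
rewrite (sum_triangle (fun m => P`_m * r (n - m)%N)) coefMr big_ord_recr /=.
rewrite subnn theta_coef0 mul0r addr0; apply: eq_bigr => m _.
have mn := ltn_ord m.
rewrite coef_theta coef_poly ifT; last by lia.
have -> : (n - m)%N = (n - m).-1.+1 by lia.
by rewrite mulrC mulrnAl.
Qed.

End ConvolutionCumulants.

(** * Moments of the infinitesimal convolution with a point mass *)

Lemma coef1_prod_linear (A : comNzRingType) (T : finType) (S : {set T}) (a b : T -> A) :
  (\prod_(i in S) ((a i)%:P + b i *: 'X))`_1 =
  \sum_(i in S) b i * \prod_(j in S :\ i) a j.
Proof.
have c0 (S' : {set T}) : (\prod_(i in S') ((a i)%:P + b i *: 'X))`_0 = \prod_(j in S') a j.
  elim/big_rec2: _ => [|i x y _ ih]; first by rewrite coef1.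
  by rewrite coef0M ih coefD coefC coefZ coefX mulr0 addr0.
elim: {S}#|S| {-2}S (leqnn #|S|) => [|n ih] S.
  by rewrite leqn0 cards_eq0 => /eqP->; rewrite !big_set0 coef1.
have [->|[x xS]] := set_0Vmem S; first by rewrite !big_set0 coef1.
rewrite (cardsD1 x) xS add1n ltnS => cS.
rewrite (big_setD1 x) //= coefM !big_ord_recl big_ord0 addr0 /= /bump /=.
rewrite !coefD !coefC !coefZ !coefX /= mulr0 addr0 add0r mulr1 addn0.
rewrite ih // c0 addrC [RHS](big_setD1 x) //=; congr (_ + _).
rewrite mulr_sumr; apply: eq_bigr => i; rewrite !inE => /andP[ix iS].
rewrite [in RHS](big_setD1 x) /=; last by rewrite !inE eq_sym ix.
rewrite mulrCA; congr (_ * (_ * _)); apply: eq_bigl => j; rewrite !inE.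
by rewrite !andbA [(j != x) && _]andbC.
Qed.

Section ConvolutionMoments.
Variable R : realType.
Implicit Types (m r delta : nat -> R).

Lemma free_cumulant_unique m u :
  (forall n, (0 < n)%N -> m n = \sum_(pi in NC n) upart u pi) ->
  forall n, (0 < n)%N -> free_cumulant m n = u n.
Proof.
move=> mu; elim/ltn_ind => n ih n0.
have := moment_free_cumulant m n0; rewrite mu //.
rewrite (bigD1 [set [set: 'I_n]]) ?one_block_NC //=.
rewrite [RHS](bigD1 [set [set: 'I_n]]) ?one_block_NC //=.
have one v : upart v [set [set: 'I_n]] = v n :> R.
  by rewrite /upart big_set1 cardsT card_ord.
rewrite !one => /esym; rewrite [X in _ + X = _](_ : _ =
  \sum_(pi in NC n | pi != [set [set: 'I_n]]) upart u pi); first exact: addIr.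
apply: eq_bigr => pi /andP[P pi1]; apply: eq_bigr => V Vp.
apply: ih; first exact: block_lt P pi1 Vp.
have part : partition pi [set: 'I_n] by move: P; rewrite inE => /andP[].
by rewrite card_gt0 (partition_neq0 part).
Qed.

Definition point_mass_cumulant (s : nat) : R := (s == 1%N)%:R.

Lemma point_mass_free_cumulant m : (forall n, m n = 1) ->
  forall n, (0 < n)%N -> free_cumulant m n = point_mass_cumulant n.
Proof.
move=> m1; apply: free_cumulant_unique => n n0; rewrite m1.
pose x0 := Ordinal n0.
rewrite (eq_bigr (fun pi => if pi == one_nontrivial_block [set x0] then 1 else 0)).
  rewrite -big_mkcondr (big_pred1 (one_nontrivial_block [set x0])) //= => pi /=.
  case: eqP => [->|_]; rewrite ?andbF // one_nontrivial_block_NC //.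
  by apply/set0Pn; exists x0; rewrite inE.
move=> pi; rewrite inE => /andP[P _]; rewrite (upart_point_mass _ _ x0) //.
- by case: eqP.
- by move=> s; rewrite /point_mass_cumulant; case: s => [|[|]].
Qed.

Lemma eq_upart n u v (pi : {set {set 'I_n}}) : partition pi [set: 'I_n] ->
  (forall s, (0 < s)%N -> u s = v s) -> upart u pi = upart v pi :> R.
Proof.
move=> P uv; apply: eq_bigr => V Vp; apply: uv.
by rewrite card_gt0 (partition_neq0 P).
Qed.

Lemma eq_dpart n v u u' (pi : {set {set 'I_n}}) : partition pi [set: 'I_n] ->
  (forall s, (0 < s)%N -> u s = u' s) -> dpart v u pi = dpart v u' pi :> R.
Proof.
move=> P uv; apply: eq_bigr => V Vp; congr (_ * _).
apply: eq_bigr => U; rewrite inE => /andP[_ Up]; apply: uv.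
by rewrite card_gt0 (partition_neq0 P).
Qed.

Lemma dpartD n v v' u (pi : {set {set 'I_n}}) :
  dpart (fun s => v s + v' s) u pi = dpart v u pi + dpart v' u pi :> R.
Proof. by rewrite -big_split; apply: eq_bigr => V _; rewrite mulrDl. Qed.

Lemma nc_sum_derivative r delta n :
  (nc_sum (fun s => (r s)%:P + delta s *: 'X) 0 n)`_1 =
  \sum_(pi in NC n) dpart delta r pi.
Proof.
rewrite -NC_sumE coef_sum; apply: eq_bigr => pi _.
by rewrite (coef1_prod_linear _ (fun V : {set 'I_n} => r #|V|) (fun V : {set 'I_n} => delta #|V|)).
Qed.

Lemma moment_series N m : m 0%N = 1 ->
  nc_series (free_cumulant m) N = \poly_(i < N) m i.
Proof.
move=> m0; apply/polyP => i; rewrite !coef_poly; case: ifP => // _.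
case: i => [|i]; first by rewrite m0.
by rewrite -NC_sumE moment_free_cumulant.
Qed.

Section Convolution.
Variables m m' e b g g' : nat -> R.
Hypotheses (m0 : m 0%N = 1) (g0 : g 0%N = 1) (e1 : forall n, e n = 1).
Hypothesis gE : forall n, (0 < n)%N -> free_cumulant g n =
  \sum_(pi in NC n) upart (free_cumulant m) pi * upart (free_cumulant e) (Kr pi).
Hypothesis g'E : forall n, (0 < n)%N -> inf_free_cumulant g g' n =
  \sum_(pi in NC n)
    (dpart (inf_free_cumulant m m') (free_cumulant m) pi *
       upart (free_cumulant e) (Kr pi) +
     upart (free_cumulant m) pi *
       dpart (inf_free_cumulant e b) (free_cumulant e) (Kr pi)).

Let c := inf_free_cumulant e b.
Let r := free_cumulant m.

Let p1 : point_mass_cumulant 1 = 1. Proof. by []. Qed.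
Let p_other s : (1 < s)%N -> point_mass_cumulant s = 0.
Proof. by case: s => [|[|]]. Qed.
Let eE := point_mass_free_cumulant e1.

Lemma convolution_free_cumulant n : (0 < n)%N -> free_cumulant g n = r n.
Proof.
move=> n0; rewrite gE //.
rewrite (eq_bigr (fun pi => upart r pi * upart point_mass_cumulant (Kr pi))); last first.
  by move=> pi _; rewrite (eq_upart (Kr_partition pi) eE).
by rewrite Kr_point_mass_upart // /upart big_set1 cardsT card_ord.
Qed.

Lemma convolution_moment n : g n = m n.
Proof.
case: n => [|n]; first by rewrite g0 m0.
rewrite !moment_free_cumulant //; apply: eq_bigr => pi; rewrite inE => /andP[P _].
exact: eq_upart P convolution_free_cumulant.
Qed.

(** A partition with at most one nontrivial block is determined by that block,
    whence the binomial coefficients: the c_k are the moments of the infinitesimal law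
    after translation of the point 1 to the origin. *)
Lemma inf_cumulant_binomial n : (0 < n)%N ->
  b n = \sum_(1 <= k < n.+1) c k *+ 'C(n, k).
Proof.
move=> n0; rewrite (moment_inf_free_cumulant e b n0).
rewrite -(one_nontrivial_block_sum_NC c n p1 p_other).
apply: eq_bigr => pi; rewrite inE => /andP[P _].
exact: eq_dpart P eE.
Qed.

Let delta n := inf_free_cumulant g g' n - inf_free_cumulant m m' n.

(** In the definition of the infinitesimal cumulants of the convolution, the first
    half of the sum only keeps the one-block partition, and the second half only keeps
    the partitions into cyclic intervals. *)
Let deltaE n N : (0 < n < N)%N ->
  delta n = (theta (pos_series N r) *
    ((\poly_(k < N) c k.+1) \Po pos_series N r))`_n.
Proof.
move=> /andP[n0 nN]; rewrite /delta g'E // big_split /=.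
rewrite -convolution_cumulants //.
rewrite -(Kr_point_mass_sum c n p1 p_other).
have -> : \sum_(pi in NC n) dpart (inf_free_cumulant m m') (free_cumulant m) pi *
    upart (free_cumulant e) (Kr pi) = inf_free_cumulant m m' n.
  rewrite (eq_bigr (fun pi => dpart (inf_free_cumulant m m') r pi *
    upart point_mass_cumulant (Kr pi))); last first.
    by move=> pi _; rewrite (eq_upart (Kr_partition pi) eE).
  rewrite Kr_point_mass_upart //.
  by rewrite /dpart /upart !big_set1 cardsT card_ord setDv big_set0 mulr1.
rewrite addrAC subrr add0r; apply: eq_bigr => pi _; congr (_ * _).
exact: eq_dpart (Kr_partition pi) eE.
Qed.

Let momentD n : (0 < n)%N -> g' n - m' n = \sum_(pi in NC n) dpart delta r pi.
Proof.
move=> n0; rewrite (moment_inf_free_cumulant g g' n0).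
rewrite (moment_inf_free_cumulant m m' n0) -sumrB.
apply: eq_bigr => pi; rewrite inE => /andP[P _].
rewrite (eq_dpart _ P convolution_free_cumulant) -/r; apply/eqP.
rewrite subr_eq addrC -dpartD; apply/eqP; apply: eq_bigr => V _.
by rewrite /delta subrKC.
Qed.

(** The infinitesimal moments are linear in the infinitesimal cumulants, and
    their difference is the one produced by the perturbation [delta], to which
    [cumulant_to_moment_series] applies. *)
Theorem convolution_inf_moment n N : (0 < n < N)%N ->
  let psi := pos_series N m in
  g' n - m' n = (theta psi * ((\poly_(k < N) c k.+1) \Po psi))`_n.
Proof.
move=> /andP[n0 nN] psi; rewrite momentD // -nc_sum_derivative.
set dM := \poly_(n < N) (nc_sum (fun s => (r s)%:P + delta s *: 'X) 0 n)`_1.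
have -> : (nc_sum (fun s => (r s)%:P + delta s *: 'X) 0 n)`_1 = dM`_n.
  by rewrite coef_poly nN.
have fe := @functional_equation _ r N.
have fd := @functional_equation_derivative _ r delta N.
have -> : psi = \poly_(i < N) m i - 1.
  apply/polyP => i; rewrite coefB coef1 !coef_poly; case: ifP => iN.
    by case: i iN => [|i] _; rewrite ?subr0 // m0 subrr.
  by case: i iN => [|i]; [rewrite (leq_trans _ nN)|rewrite subr0].
rewrite -(moment_series N m0) -/r.
apply: (cumulant_to_moment_series fe fd) => // i iN.
rewrite coef_poly iN; case: i iN => [|i] iN.
  by rewrite coef0M theta_coef0 mul0r.
by rewrite (@deltaE _ N).
Qed.

End Convolution.
End ConvolutionMoments.

(** * Newton's identities *)

Section Newton.
Variable F : comNzRingType.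
Implicit Types (s : seq F) (p q : {poly F}).

(** Newton's identities: the logarithmic derivative of 1 - z X is a geometric
    series, and these add up over the roots. *)
Lemma newton_prod N s :
  eqX N (- theta (\prod_(z <- s) (1 - z *: 'X)))
        (\prod_(z <- s) (1 - z *: 'X) *
           pos_series N (fun n => \sum_(z <- s) z ^+ n)).
Proof.
elim: s => [|z s ih].
  move=> i iN; rewrite !big_nil mul1r coefN coef_theta coef1 coef_poly iN.
  by case: i iN => [|i] _; rewrite ?big_nil ?mulr0n ?mul0rn oppr0.
rewrite !big_cons thetaM opprD.
set P := \prod_(w <- s) _ in ih *.
have E : pos_series N (fun n => \sum_(w <- z :: s) w ^+ n) =
    pos_series N (fun n => z ^+ n) + pos_series N (fun n => \sum_(w <- s) w ^+ n).
  apply/polyP => i; rewrite coefD !coef_poly; case: ifP => _; last by rewrite addr0.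
  by case: i => [|i]; rewrite ?addr0 // big_cons.
have G : eqX N (- theta (1 - z *: 'X)) ((1 - z *: 'X) * pos_series N (fun n => z ^+ n)).
  move=> i iN; rewrite mulrBl mul1r -scalerAl coefB coefZ coefXM coefN coef_theta.
  rewrite coefB coef1 coefZ coefX !coef_poly iN.
  case: i iN => [|[|i]] iN /=.
  - by rewrite mulr0n oppr0 mulr0 subr0.
  - by rewrite if_same; ring.
  - by rewrite ltnW // exprS mulr0 subrr mul0rn oppr0 subrr.
rewrite E (_ : _ - _ = - theta (1 - z *: 'X) * P + (1 - z *: 'X) * - theta P); last by ring.
rewrite G ih.
by apply/eqX_sub; rewrite (_ : _ - _ = 0) //; ring.
Qed.

(** X^d p(1/X). The series computations take place in the variable 1/x, near the
    point at infinity of [p]. *)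
Definition rev_poly d p : {poly F} := \poly_(k < d.+1) p`_(d - k).

Lemma coef_rev_poly d p k : (rev_poly d p)`_k = if (k <= d)%N then p`_(d - k) else 0.
Proof. by rewrite coef_poly ltnS. Qed.

Lemma rev_poly_prod s :
  rev_poly (size s) (\prod_(z <- s) ('X - z%:P)) = \prod_(z <- s) (1 - z *: 'X).
Proof.
elim: s => [|z s ih] /=.
  rewrite !big_nil; apply/polyP => k; rewrite coef_rev_poly coef1.
  by case: k => [|k] /=; rewrite ?coef1.
rewrite !big_cons -ih; set Q := \prod_(w <- s) _.
have Qs : size Q = (size s).+1 by rewrite /Q size_prod_XsubC.
apply/polyP => k; rewrite coef_rev_poly !mulrBl mul1r -scalerAl !coefB coefZ !coefXM.
rewrite mul_polyC coefZ !coef_rev_poly.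
case: k => [|k] /=.
  by rewrite !subn0 /= [Q`_(size s).+1]nth_default ?Qs // !mulr0.
rewrite subSS; case: (ltngtP k (size s)) => h.
- have -> : (size s - k == 0)%N = false by lia.
  by rewrite ltnW // subnS.
- by rewrite ltnNge h mulr0 subr0.
- by rewrite h ltnSn subnn eqxx.
Qed.

End Newton.

(** * Finite-free convolution as a differential operator *)

Section RealPolynomials.
Variable R : realType.
Implicit Types (p q : {poly R}) (d n N : nat).

Lemma size_complex_roots d p : monic_of_degree d p -> size (complex_roots p) = d.
Proof.
move=> [pm ps]; apply: succn_inj; rewrite -(size_prod_XsubC _ id) -complex_rootsE //.
by rewrite /complexify size_map_poly.
Qed.

Lemma sum_complex_roots d p n : (0 < d)%N -> monic_of_degree d p ->
  \sum_(z <- complex_roots p) z ^+ n = (d%:R * poly_moment p n)%:C%C.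
Proof.
move=> d0 [pm ps]; rewrite rmorphM rmorph_nat /= poly_momentE //.
by rewrite /complex_moment ps /= mulrA divff ?mul1r // pnatr_eq0 -lt0n.
Qed.

Lemma poly_moment0 d p : (0 < d)%N -> monic_of_degree d p -> poly_moment p 0 = 1.
Proof.
move=> d0 pd; have d0' : d%:R != 0 :> R by rewrite pnatr_eq0 -lt0n.
apply: (mulfI d0'); rewrite mulr1; apply: (fmorph_inj (real_complex R)).
rewrite /= -(sum_complex_roots 0 d0 pd).
under eq_bigr do rewrite expr0.
by rewrite big_const_seq count_predT (size_complex_roots pd) iter_addr_0 rmorph_nat.
Qed.

Lemma newton_rev_poly d p N : (0 < d)%N -> monic_of_degree d p ->
  eqX N (- theta (rev_poly d p))
        (rev_poly d p * pos_series N (fun n => d%:R * poly_moment p n)).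
Proof.
move=> d0 pd i iN; apply: (fmorph_inj (real_complex R)).
rewrite -[LHS](coef_map (real_complex R)) -[RHS](coef_map (real_complex R)) [in LHS]rmorphN [in RHS]rmorphM /=.
have Et : map_poly (real_complex R) (theta (rev_poly d p)) =
    theta (map_poly (real_complex R) (rev_poly d p)).
  by rewrite /theta rmorphM /= map_polyX deriv_map.
have Er : map_poly (real_complex R) (rev_poly d p) =
    \prod_(z <- complex_roots p) (1 - z *: 'X).
  rewrite -rev_poly_prod -complex_rootsE; last by case: pd.
  rewrite (size_complex_roots pd); apply/polyP => k.
  rewrite coef_map /= !coef_rev_poly; case: ifP => _; last by rewrite rmorph0.
  by rewrite coef_map.
rewrite Et Er (newton_prod _ iN); congr ((polyseq (_ * _))`_i).
apply/polyP => k; rewrite coef_map /= !coef_poly; case: ifP => _; last by rewrite rmorph0.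
case: k => [|k]; first by rewrite rmorph0.
by rewrite (sum_complex_roots _ d0 pd).
Qed.

Lemma monic_shift d q : monic_of_degree d q -> monic_of_degree d (q \Po ('X + 1%:P)).
Proof.
move=> [qm qs]; split; last by rewrite size_comp_poly2 ?size_XaddC.
rewrite monicE lead_coef_comp ?size_XaddC // lead_coefXaddC expr1n mulr1.
exact: qm.
Qed.

Lemma poly_moment_shift d q n : (0 < d)%N -> monic_of_degree d q ->
  d%:R * poly_moment q n =
  \sum_(k < n.+1) d%:R * poly_moment (q \Po ('X + 1%:P)) k *+ 'C(n, k).
Proof.
move=> d0 qd; have qd1 := monic_shift qd; set q1 := _ \Po _ in qd1 *.
apply: (fmorph_inj (real_complex R)).
rewrite /= -(sum_complex_roots n d0 qd) rmorph_sum /=.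
under [RHS]eq_bigr do rewrite rmorphMn /= -(sum_complex_roots _ d0 qd1).
have ss : perm_eq (complex_roots q1) [seq z - 1 | z <- complex_roots q].
  apply/allP => z _ /=; rewrite -!mu_prod_XsubC big_map -complex_rootsE; last by case: qd1.
  have -> : complexify q1 = complexify q \Po ('X + 1%:P).
    by rewrite /complexify map_comp_poly rmorphD /= map_polyX map_polyC /= rmorph1.
  rewrite complex_rootsE; last by case: qd.
  rewrite rmorph_prod /=; apply/eqP; congr (mup z _); apply: eq_bigr => w _.
  by rewrite comp_polyB comp_polyX comp_polyC polyCB; ring.
under [RHS]eq_bigr do rewrite (perm_big _ ss) /= big_map -sumrMnl.
rewrite exchange_big /=; apply: eq_bigr => z _.
rewrite -{1}[z](subrK 1) addrC exprDn; apply: eq_bigr => k _.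
by rewrite expr1n mul1r.
Qed.

Lemma poly_shiftK q : (q \Po ('X + 1%:P)) \Po ('X - 1%:P) = q.
Proof.
by rewrite -comp_polyA comp_polyD comp_polyX comp_polyC subrK comp_polyXr.
Qed.

Lemma coef_XsubC1_exp i m : (('X - 1%:P) ^+ i : {poly R})`_m =
  if (m <= i)%N then (-1) ^+ (i - m) * 'C(i, m)%:R else 0.
Proof.
rewrite -polyCN addrC exprDn coef_sum.
case: leqP => mi; last first.
  rewrite big1 // => j _; have := ltn_ord j => ji.
  rewrite coefMn -polyC_exp coefCM coefXn.
  have -> : (m == j) = false by lia.
  by rewrite mulr0 mul0rn.
have mi' : (m < i.+1)%N by lia.
rewrite (bigD1 (Ordinal mi')) //= big1 ?addr0 => [|j].
  by rewrite coefMn -polyC_exp coefCM coefXn eqxx mulr1 mulr_natr.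
rewrite -(inj_eq val_inj) /= coefMn -polyC_exp coefCM coefXn eq_sym => /negbTE->.
by rewrite mulr0 mul0rn.
Qed.

Lemma bin_ratio d k j : (j <= k <= d)%N ->
  'C(d - j, d - k)%:R / 'C(d, k)%:R = (k ^_ j)%:R / (d ^_ j)%:R :> R.
Proof.
move=> /andP[jk kd].
have C0 : 'C(d, k)%:R != 0 :> R by rewrite pnatr_eq0 -lt0n bin_gt0.
have f0 : (d ^_ j)%:R != 0 :> R by rewrite pnatr_eq0 -lt0n ffact_gt0; lia.
apply/eqP; rewrite eqr_div // -!natrM; apply/eqP; congr _%:R.
have f1 : (0 < (k - j)`! * (d - k)`!)%N by rewrite muln_gt0 !fact_gt0.
apply/eqP; rewrite -(eqn_pmul2r f1); apply/eqP.
transitivity (d`!).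
  rewrite -(@ffact_fact d j); last lia.
  have dk : (d - k <= d - j)%N by lia.
  have := bin_fact dk; have -> : (d - j - (d - k) = k - j)%N by lia.
  by move <-; ring.
rewrite -(bin_fact kd) -(ffact_fact jk); ring.
Qed.

Lemma coef_rev_ffmul d p q k : (k <= d)%N ->
  (rev_poly d (ffmul d p q))`_k = (rev_poly d p)`_k * ecoef d q k.
Proof.
move=> kd; rewrite !coef_rev_poly kd /ffmul coef_sum.
have kd' : (k < d.+1)%N by lia.
rewrite (bigD1 (Ordinal kd')) //= big1 ?addr0 => [|i].
  rewrite coefZ coefXn eqxx mulr1 mulrA; congr (_ * _).
  have C0 : 'C(d, k)%:R != 0 :> R by rewrite pnatr_eq0 -lt0n bin_gt0.
  by rewrite /ecoef mulrACA signrMK mulfV // mulr1.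
rewrite -(inj_eq val_inj) /= => ik; rewrite coefZ coefXn.
have -> : (d - k == d - i)%N = false by have := ltn_ord i; move/eqP: ik; lia.
by rewrite mulr0.
Qed.

Section FiniteFreeConvolution.
Variables (d : nat) (p q : {poly R}).
Hypotheses (d0 : (0 < d)%N) (pd : monic_of_degree d p) (qd : monic_of_degree d q).

Let q1 := q \Po ('X + 1%:P).
Let q1d : monic_of_degree d q1 := monic_shift qd.

Lemma rev_poly_monic p' : monic_of_degree d p' -> (rev_poly d p')`_0 = 1.
Proof.
move=> [/monicP pm ps]; rewrite coef_rev_poly subn0 -pm lead_coefE ps //.
Qed.

Lemma ecoef_shift k : (k <= d)%N ->
  ecoef d q k = \sum_(j < k.+1) (-1) ^+ j * (rev_poly d q1)`_j *
    ((k ^_ j)%:R / (d ^_ j)%:R).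
Proof.
move=> kd; rewrite /ecoef -{1}(poly_shiftK q) -/q1.
have szq : (size q1 <= d.+1)%N by case: q1d => _ ->.
have -> : q1 \Po ('X - 1%:P) = \sum_(i < d.+1) q1`_i *: ('X - 1%:P) ^+ i.
  rewrite -comp_poly_lincomb; congr (_ \Po _); apply/polyP => i.
  rewrite coef_poly; case: ltnP => // di; rewrite nth_default //.
  exact: leq_trans szq di.
rewrite coef_sum (reindex_inj rev_ord_inj) /= mulr_sumr mulr_suml.
rewrite [RHS](big_ord_widen d.+1 (fun j => (-1) ^+ j * (rev_poly d q1)`_j *
    ((k ^_ j)%:R / (d ^_ j)%:R))); last by lia.
rewrite [RHS]big_mkcond /=; apply: eq_bigr => j _; have jd := ltn_ord j.
rewrite subSS coefZ coef_XsubC1_exp.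
have -> : (d - k <= d - j)%N = (j < k.+1)%N by lia.
case: ifP => jk; last by rewrite !mulr0 mul0r.
rewrite -bin_ratio; last lia.
rewrite coef_rev_poly ifT; last lia.
have -> : (d - j - (d - k) = k - j)%N by lia.
have -> : (-1) ^+ k = (-1) ^+ j * (-1) ^+ (k - j) :> R.
  by rewrite -exprD subnKC //; lia.
have S : (-1) ^+ (k - j) * (-1) ^+ (k - j) = 1 :> R.
  by rewrite -exprD addnn -signr_odd odd_double.
move: ((-1) ^+ (k - j)) ((-1) ^+ j) (q1`_ _) ('C(_, _)%:R) ('C(_, _)%:R)^-1 S.
by move=> b a x y z S; rewrite -[RHS]mul1r -S; ring.
Qed.

(** The polynomial [q] is expanded in powers of x - 1, since its roots accumulate at
    1. Convolution with [p] is linear, and it turns (x - 1)^(d - j) into a multiple of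
    X^j times the j-th derivative of the reversed [p]: this is the identity
    [bin_ratio] between binomial coefficients. *)
Lemma rev_ffmul N : eqX N (rev_poly d (ffmul d p q))
  (\sum_(j < N) ((-1) ^+ j * (rev_poly d q1)`_j / (d ^_ j)%:R) *:
      ('X^j * (rev_poly d p)^`(j))).
Proof.
move=> k kN; rewrite coef_sum.
have E j : ('X^j * (rev_poly d p)^`(j))`_k = (rev_poly d p)`_k * (k ^_ j)%:R.
  rewrite coefXnM coef_derivn; case: ltnP => kj; first by rewrite ffact_small ?mulr0.
  by rewrite subnKC // mulr_natr.
have [kd|dk] := leqP k d; last first.
  rewrite coef_rev_poly leqNgt dk /= big1 // => j _.
  by rewrite coefZ E coef_rev_poly leqNgt dk /= mul0r mulr0.
rewrite coef_rev_ffmul // ecoef_shift // mulr_sumr.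
rewrite (big_ord_widen N (fun j => (rev_poly d p)`_k * ((-1) ^+ j * (rev_poly d q1)`_j *
    ((k ^_ j)%:R / (d ^_ j)%:R)))) // big_mkcond /=; apply: eq_bigr => j _.
rewrite coefZ E; case: ifP => jk; first by ring.
by move/negbT: jk; rewrite -leqNgt => kj; rewrite (@ffact_small k j) // !mulr0.
Qed.

Lemma monic_ffmul : monic_of_degree d (ffmul d p q).
Proof.
have sz : (size (ffmul d p q) <= d.+1)%N.
  apply/leq_sizeP => i di; rewrite coef_sum big1 // => k _.
  rewrite coefZ coefXn; have -> : (i == d - k)%N = false by lia.
  by rewrite mulr0.
have c1 : (ffmul d p q)`_d = 1.
  have := coef_rev_ffmul p q (leq0n d); rewrite (rev_poly_monic pd) mul1r.
  rewrite coef_rev_poly subn0 /= => ->.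
  rewrite /ecoef expr0 mul1r bin0 divr1 subn0.
  by have := rev_poly_monic qd; rewrite coef_rev_poly subn0.
have sz' : size (ffmul d p q) = d.+1.
  apply/eqP; rewrite eqn_leq sz /= ltnNge; apply/negP => /leq_sizeP/(_ d (leqnn d)).
  by rewrite c1 => /eqP; rewrite oner_eq0.
by split; rewrite // monicE lead_coefE sz' c1.
Qed.

(** X^j P^(j) / P divided by (-d)^j, for P the reversed polynomial of [p]: the
    recursion is the product rule for theta, with theta P = - d psi P. It is normalised
    so that only the term psi^j remains when d goes to infinity. *)
Fixpoint scaled_deriv (psi : {poly R}) j : {poly R} :=
  if j is i.+1 then
    - d%:R^-1 *: (theta (scaled_deriv psi i) - scaled_deriv psi i *+ i)
      + psi * scaled_deriv psi i
  else 1.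

Lemma scaled_derivP N j :
  let psi := pos_series N (poly_moment p) in
  eqX N ('X^j * (rev_poly d p)^`(j))
        ((- d%:R) ^+ j *: (scaled_deriv psi j * rev_poly d p)).
Proof.
move=> psi; have dn0 : d%:R != 0 :> R by rewrite pnatr_eq0 -lt0n.
set rp := rev_poly d p.
have hN : eqX N (theta rp) (- (d%:R *: psi * rp)).
  rewrite -[theta rp]opprK (@newton_rev_poly _ _ N d0 pd) -/rp.
  apply/eqX_sub; rewrite (_ : _ - _ = 0) //; apply/eqP; rewrite subr_eq0; apply/eqP.
  rewrite mulrC; congr (- (_ * _)); apply/polyP => i; rewrite coefZ !coef_poly.
  by case: ifP => _; [case: i => [|i]; rewrite ?mulr0|rewrite mulr0].
elim: j => [|j ih]; first by rewrite !expr0 scale1r !mul1r derivn0.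
have -> : 'X^(j.+1) * rp^`(j.+1) = theta ('X^j * rp^`(j)) - ('X^j * rp^`(j)) *+ j.
  rewrite /theta derivM derivXn derivnS exprS.
  case: j {ih} => [|j]; first by rewrite mulr0n mulr0n mul0r subr0; ring.
  by rewrite /= exprS mulrnAl mulrDr -mulrnAr; ring.
rewrite -mulr_natr ih /theta derivZ derivM -scalerAr mulrDr.
have -> : 'X * (scaled_deriv psi j * rp^`()) = scaled_deriv psi j * theta rp.
  by rewrite /theta; ring.
rewrite hN /= -/(theta _).
apply/eqX_sub; rewrite (_ : _ - _ = 0) //; apply/eqP; rewrite subr_eq0; apply/eqP.
rewrite exprS -[(- d%:R * _)]mulrC -!mul_polyC !polyCM !polyCN.
have I : d%:R%:P * (d%:R^-1)%:P = 1 :> {poly R} by rewrite -polyCM mulfV.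
rewrite /theta; ring: I.
Qed.

(** The quotient of the reversed convolution by the reversed [p], as a series. *)
Definition ffmul_factor N : {poly R} :=
  \sum_(j < N) ((rev_poly d q1)`_j * (d%:R ^+ j / (d ^_ j)%:R)) *:
     scaled_deriv (pos_series N (poly_moment p)) j.

Lemma rev_ffmul_factor N :
  eqX N (rev_poly d (ffmul d p q)) (rev_poly d p * ffmul_factor N).
Proof.
rewrite rev_ffmul mulr_sumr; apply: eqX_sum => j _.
rewrite (@scaled_derivP N j) scalerA.
apply/eqX_sub; rewrite (_ : _ - _ = 0) //; apply/eqP; rewrite subr_eq0; apply/eqP.
rewrite -scalerAr [rev_poly d p * _]mulrC; congr (_ *: _).
have S : (-1) ^+ j * (-1) ^+ j = 1 :> R by rewrite -exprD addnn -signr_odd odd_double.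
rewrite -[- d%:R]mulN1r exprMn.
move: ((-1) ^+ j) ((rev_poly d q1)`_j) (d ^_ j)%:R^-1 (d%:R ^+ j) S => a b c e S.
by rewrite -[RHS]mul1r -S; ring.
Qed.

Lemma ffmul_factor0 N : (0 < N)%N -> (ffmul_factor N)`_0 = 1.
Proof.
move=> N0; have := rev_ffmul_factor N0.
rewrite coef0M (rev_poly_monic pd) (rev_poly_monic monic_ffmul) mul1r; exact: esym.
Qed.

(** The factorisation [rev_ffmul_factor] adds logarithmic derivatives, and by
    Newton's identities these are the generating series of the moments. *)
Lemma ffmul_factor_moments N :
  eqX N (ffmul_factor N * pos_series N (fun n =>
           d%:R * (poly_moment (ffmul d p q) n - poly_moment p n)))
        (- theta (ffmul_factor N)).
Proof.
set H := ffmul_factor N; set f := ffmul d p q; set rp := rev_poly d p.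
have rp0 : rp`_0 = 1 by apply: rev_poly_monic.
have -> : pos_series N (fun n => d%:R * (poly_moment f n - poly_moment p n)) =
    pos_series N (fun n => d%:R * poly_moment f n) -
    pos_series N (fun n => d%:R * poly_moment p n).
  apply/polyP => i; rewrite coefB !coef_poly; case: ifP => _; last by rewrite subr0.
  by case: i => [|i]; rewrite ?subr0 // mulrBr.
have Np := @newton_rev_poly _ _ N d0 pd.
have Nf := @newton_rev_poly _ _ N d0 monic_ffmul.
rewrite -/f -/rp in Np Nf.
set F := pos_series N _ in Nf *; set P := pos_series N _ in Np *.
have hf : eqX N (rev_poly d f) (rp * H) := @rev_ffmul_factor N.
apply: (eqX_cancel rp0).
have E : eqX N (rp * H * F) (rp * P * H - rp * theta H).
  rewrite -hf -Nf hf thetaM -Np.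
  by apply/eqX_sub; rewrite (_ : _ - _ = 0) //; ring.
rewrite mulrBr mulrBr mulrA E.
by apply/eqX_sub; rewrite (_ : _ - _ = 0) //; ring.
Qed.

End FiniteFreeConvolution.

End RealPolynomials.

(** * Convergence of coefficients *)

From mathcomp Require Import all_classical all_reals all_analysis.
Import numFieldNormedType.Exports.

Section SequenceLimits.
Local Open Scope classical_set_scope.

Section Sequences.
Variable R : realType.
Implicit Types (u v : nat -> R) (f g : nat -> {poly R}).

Lemma seq_cvg_sum (I : Type) (s : seq I) (P : pred I) (u : I -> nat -> R) (l : I -> R) :
  (forall i, P i -> u i d @[d --> \oo] --> l i) ->
  \sum_(i <- s | P i) u i d @[d --> \oo] --> \sum_(i <- s | P i) l i.
Proof. by move=> h; apply: cvg_big => //; apply: add_continuous. Qed.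

Lemma seq_cvg_pos u v (l : R) : (forall d, (0 < d)%N -> u d = v d) ->
  v d @[d --> \oo] --> l -> u d @[d --> \oo] --> l.
Proof.
move=> uv; apply: cvg_trans; apply: near_eq_cvg; near=> d.
by apply/esym/uv; near: d; exact: nbhs_infty_gt.
Unshelve. all: by end_near. Qed.

Lemma seq_cvg_eq u v (l : R) : u =1 v -> v d @[d --> \oo] --> l -> u d @[d --> \oo] --> l.
Proof. by move=> uv; apply: seq_cvg_pos => d _; apply: uv. Qed.

Lemma seq_cvg_uniq u (l l' : R) :
  u d @[d --> \oo] --> l -> u d @[d --> \oo] --> l' -> l = l'.
Proof. by move=> h h'; apply: (cvg_unique _ h h'). Qed.

Lemma seq_cvgM u v (a b : R) : u d @[d --> \oo] --> a -> v d @[d --> \oo] --> b ->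
  u d * v d @[d --> \oo] --> a * b.
Proof. by move=> hu hv; apply: cvgM. Qed.

Lemma seq_cvgV u (a : R) : a != 0 -> u d @[d --> \oo] --> a ->
  (u d)^-1 @[d --> \oo] --> a^-1.
Proof. by move=> a0 hu; apply: cvgV. Qed.

Definition coef_cvg N f (l : {poly R}) :=
  forall i, (i < N)%N -> (f d)`_i @[d --> \oo] --> l`_i.

Lemma coef_cvg_cst N (p : {poly R}) : coef_cvg N (fun=> p) p.
Proof. by move=> i _; apply: cvg_cst. Qed.

Lemma coef_cvgD N f g l k : coef_cvg N f l -> coef_cvg N g k ->
  coef_cvg N (fun d => f d + g d) (l + k).
Proof.
move=> hf hg i iN; rewrite coefD; apply: seq_cvg_eq (cvgD (hf i iN) (hg i iN)).
by move=> d; rewrite coefD.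
Qed.

Lemma coef_cvgN N f l : coef_cvg N f l -> coef_cvg N (fun d => - f d) (- l).
Proof.
move=> hf i iN; rewrite coefN; apply: seq_cvg_eq (cvgN (hf i iN)).
by move=> d; rewrite coefN.
Qed.

Lemma coef_cvgM N f g l k : coef_cvg N f l -> coef_cvg N g k ->
  coef_cvg N (fun d => f d * g d) (l * k).
Proof.
move=> hf hg i iN; rewrite coefM.
apply: (@seq_cvg_eq _ (fun d => \sum_(j < i.+1) (f d)`_j * (g d)`_(i - j))).
  by move=> d; rewrite coefM.
apply: seq_cvg_sum => j _; have ji := ltn_ord j.
by apply: cvgM; [apply: hf|apply: hg]; lia.
Qed.

Lemma coef_cvgZ N u f (a : R) l : u d @[d --> \oo] --> a -> coef_cvg N f l ->
  coef_cvg N (fun d => u d *: f d) (a *: l).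
Proof.
move=> hu hf i iN; rewrite coefZ; apply: seq_cvg_eq (cvgM hu (hf i iN)).
by move=> d; rewrite coefZ.
Qed.

Lemma coef_cvg_sum N (I : Type) (s : seq I) (P : pred I)
    (f : I -> nat -> {poly R}) (l : I -> {poly R}) :
  (forall i, P i -> coef_cvg N (f i) (l i)) ->
  coef_cvg N (fun d => \sum_(i <- s | P i) f i d) (\sum_(i <- s | P i) l i).
Proof.
move=> h k kN; rewrite coef_sum.
apply: (@seq_cvg_eq _ (fun d => \sum_(i <- s | P i) (f i d)`_k)).
  by move=> d; rewrite coef_sum.
by apply: seq_cvg_sum => i Pi; apply: h.
Qed.

Lemma coef_cvg_theta N f l : coef_cvg N f l ->
  coef_cvg N (fun d => theta (f d)) (theta l).
Proof.
move=> h i iN; rewrite coef_theta -mulr_natr.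
apply: seq_cvg_eq (cvgM (h i iN) (cvg_cst _)).
by move=> d; rewrite coef_theta /= mulr_natr.
Qed.

(** Division by a series of constant term 1 is continuous, since each coefficient
    of the quotient is a polynomial in the previous ones. *)
Lemma coef_cvg_div N f g h l k r :
  (forall d, (0 < d)%N -> (f d)`_0 = 1) ->
  (forall d, (0 < d)%N -> eqX N (f d * g d) (h d)) -> eqX N (l * k) r ->
  coef_cvg N f l -> coef_cvg N h r -> coef_cvg N g k.
Proof.
move=> f1 fg lk fl hr; elim/ltn_ind => i ih iN.
have N0 : (0 < N)%N by lia.
have l1 : l`_0 = 1.
  apply: seq_cvg_uniq (fl 0%N N0) _.
  exact: (@seq_cvg_pos _ (fun=> 1) _ f1 (cvg_cst _)).
have rec (a b c : {poly R}) : a`_0 = 1 -> eqX N (a * b) c ->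
    b`_i = c`_i - \sum_(j < i) a`_(j.+1) * b`_(i - j.+1).
  move=> a1 abc; have := abc i iN; rewrite coefM big_ord_recl a1 mul1r subn0 => <-.
  by rewrite addrK.
rewrite (rec l k r l1 lk).
apply: (@seq_cvg_pos _ (fun d => (h d)`_i - \sum_(j < i) (f d)`_(j.+1) * (g d)`_(i - j.+1))).
  by move=> d d0; apply: rec (f1 d d0) (fg d d0).
apply: cvgB; first exact: hr.
apply: seq_cvg_sum => j _; have ji := ltn_ord j.
by apply: cvgM; [apply: fl; lia|apply: ih; lia].
Qed.

Lemma cvg_invn : (d%:R^-1 : R) @[d --> \oo] --> (0 : R).
Proof.
rewrite -cvg_shiftS; apply: seq_cvg_eq cvg_harmonic.
by move=> d.
Qed.

Lemma cvg_ffact_ratio j : (d%:R ^+ j / (d ^_ j)%:R : R) @[d --> \oo] --> (1 : R).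
Proof.
have h : ((d ^_ j)%:R / d%:R ^+ j : R) @[d --> \oo] --> (1 : R).
  elim: j => [|j ih].
    by apply: seq_cvg_eq (cvg_cst _) => d; rewrite ffactn0 expr0 divr1.
  have h1 : ((d - j)%:R / d%:R : R) @[d --> \oo] --> (1 : R).
    have : (1 - j%:R * d%:R^-1 : R) @[d --> \oo] --> (1 - j%:R * 0 : R).
      by apply: cvgB; [exact: cvg_cst|apply: cvgM cvg_invn; exact: cvg_cst].
    rewrite mulr0 subr0; apply: cvg_trans; apply: near_eq_cvg; near=> d.
    have jd : (j < d)%N by near: d; exact: nbhs_infty_gt.
    rewrite natrB; last exact: ltnW.
    by rewrite mulrBl divff // pnatr_eq0; lia.
  have h2 := seq_cvgM ih h1; rewrite mulr1 in h2; apply: seq_cvg_eq h2 => d /=.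
  by rewrite ffactnSr natrM exprSr invfM mulrACA.
have h2 := seq_cvgV (oner_neq0 R) h; rewrite invr1 in h2; apply: seq_cvg_eq h2 => d /=.
by rewrite invf_div.
Unshelve. all: by end_near. Qed.

End Sequences.

(** * The limit of the differences of power sums *)

Section PowerSumLimit.
Variable R : realType.
Variables (p q : nat -> {poly R}) (m c : nat -> R).
Hypothesis pd : forall d, (0 < d)%N -> monic_of_degree d (p d).
Hypothesis qd : forall d, (0 < d)%N -> monic_of_degree d (q d).
Hypothesis pm : forall n, poly_moment (p d) n @[d --> \oo] --> m n.

Let q1 d := q d \Po ('X + 1%:P).

Hypothesis qc : forall n, (0 < n)%N ->
  d%:R * poly_moment (q1 d) n @[d --> \oo] --> c n.

Let Q d i : R := (rev_poly d (q1 d))`_i.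

Lemma pos_series_cvg N (u : nat -> nat -> R) (l : nat -> R) :
  (forall n, (0 < n)%N -> u d n @[d --> \oo] --> l n) ->
  coef_cvg N (fun d => pos_series N (u d)) (pos_series N l).
Proof.
move=> h i iN; rewrite coef_poly iN.
apply: (@seq_cvg_eq _ _ (fun d => if i is 0%N then 0 else u d i)).
  by move=> d; rewrite coef_poly iN.
by case: i {iN} => [|i]; [exact: cvg_cst|exact: h].
Qed.

Lemma rev_coef_rec (a b : {poly R}) N i : a`_0 = 1 -> (i.+1 < N)%N ->
  eqX N (- theta a) (a * b) -> b`_0 = 0 ->
  a`_i.+1 = - i.+1%:R^-1 * \sum_(j < i.+1) a`_j * b`_(i.+1 - j).
Proof.
move=> a0 iN h b0; have := h i.+1 iN.
rewrite coefN coef_theta coefM big_ord_recr /= subnn b0 mulr0 addr0 => <-.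
by rewrite mulrNN -[a`_i.+1 *+ _]mulr_natr mulrCA mulVf ?mulr1 ?pnatr_eq0.
Qed.

(** By Newton's identities the elementary symmetric functions are polynomials in
    the power sums, and so they converge along with them. *)
Lemma rev_shift_cvg i : exists l : R, Q d i @[d --> \oo] --> l.
Proof.
elim/ltn_ind: i => -[|i] ih.
  exists 1; apply: (@seq_cvg_pos _ _ (fun=> 1)); last exact: cvg_cst.
  by move=> d d0; apply: rev_poly_monic; apply: monic_shift; apply: qd.
have {ih} ih (j : 'I_i.+1) : exists l : R, Q d j @[d --> \oo] --> l by apply: ih.
have [l hl] := choice ih.
exists (- i.+1%:R^-1 * \sum_(j < i.+1) l j * c (i.+1 - j)).
apply: (@seq_cvg_pos _ _ (fun d => - i.+1%:R^-1 *
   \sum_(j < i.+1) Q d j * (d%:R * poly_moment (q1 d) (i.+1 - j)))).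
  move=> d d0; have q1d := monic_shift (qd d0).
  rewrite /Q (rev_coef_rec (N := i.+2) _ _ (newton_rev_poly d0 q1d (N := i.+2))) //.
  - congr (_ * _); apply: eq_bigr => j _; congr (_ * _); have ji := ltn_ord j.
    rewrite coef_poly ifT; last lia.
    by have -> : (i.+1 - j = (i - j).+1)%N by lia.
  - exact: rev_poly_monic.
  - by rewrite coef_poly.
apply: cvgM; first exact: cvg_cst.
apply: seq_cvg_sum => j _; have ji := ltn_ord j.
by apply: cvgM; [exact: hl|apply: qc; lia].
Qed.

Variable N : nat.
Hypothesis N0 : (0 < N)%N.

Let psi := pos_series N m.
Let cbar : {poly R} := \poly_(k < N) c k.+1.

Lemma psi0 : psi`_0 = 0. Proof. by rewrite coef_poly N0. Qed.

Lemma scaled_deriv_cvg j :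
  coef_cvg N (fun d => scaled_deriv d (pos_series N (poly_moment (p d))) j) (psi ^+ j).
Proof.
elim: j => [|j ih] /=; first by rewrite expr0; apply: coef_cvg_cst.
have -> : psi ^+ j.+1 = (- 0) *: (theta (psi ^+ j) - (psi ^+ j) * j%:R%:P) + psi * psi ^+ j.
  by rewrite oppr0 scale0r add0r exprS.
have E : (fun d => - d%:R^-1 *: (theta (scaled_deriv d (pos_series N (poly_moment (p d))) j)
     - scaled_deriv d (pos_series N (poly_moment (p d))) j *+ j)
     + pos_series N (poly_moment (p d)) * scaled_deriv d (pos_series N (poly_moment (p d))) j) =
   (fun d => - d%:R^-1 *: (theta (scaled_deriv d (pos_series N (poly_moment (p d))) j)
     - scaled_deriv d (pos_series N (poly_moment (p d))) j * j%:R%:P)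
     + pos_series N (poly_moment (p d)) * scaled_deriv d (pos_series N (poly_moment (p d))) j).
  by apply/funext => d; rewrite polyC_natr mulr_natr.
rewrite E {E}; apply: coef_cvgD; last first.
  by apply: coef_cvgM => //; apply: pos_series_cvg => n _; apply: pm.
apply: coef_cvgZ; first by apply: cvgN; exact: cvg_invn.
apply: coef_cvgD; first exact: coef_cvg_theta.
by apply: coef_cvgN; apply: coef_cvgM => //; apply: coef_cvg_cst.
Qed.

(** In the limit the quotient series becomes Q(psi), where Q is the limit of the
    reversed shifted [q]. The generating series of the differences is minus its
    logarithmic derivative, that is theta(psi) times - Q'(psi) / Q(psi), and the latter
    quotient is cbar(psi) by Newton's identities for Q. *)
Theorem ffmul_moment_difference n : (0 < n < N)%N ->
  d%:R * (poly_moment (ffmul d (p d) (q d)) n - poly_moment (p d) n) @[d --> \oo]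
    --> (theta psi * (cbar \Po psi))`_n.
Proof.
move=> /andP[n0 nN]; have [l hl] := choice rev_shift_cvg.
pose Ql : {poly R} := \poly_(j < N) l j.
pose H d := ffmul_factor d (p d) (q d) N.
have hH : coef_cvg N H (Ql \Po psi).
  rewrite comp_poly_lincomb; apply: coef_cvg_sum => j _.
  apply: coef_cvgZ; last exact: scaled_deriv_cvg.
  by rewrite -[l j]mulr1; apply: cvgM; [exact: hl|exact: cvg_ffact_ratio].
have newton_lim : eqX N (- theta Ql) (Ql * pos_series N c).
  move=> i iN.
  have hQ : coef_cvg N (fun d => rev_poly d (q1 d)) Ql.
    by move=> j jN; rewrite coef_poly jN; apply: hl.
  apply: (seq_cvg_uniq (coef_cvgN (coef_cvg_theta hQ) iN)).
  have hR := coef_cvgM hQ (@pos_series_cvg N (fun d n => d%:R * poly_moment (q1 d) n) c qc).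
  apply: (@seq_cvg_pos _ _ _ _ _ (hR i iN)) => d d0.
  exact: (newton_rev_poly d0 (monic_shift (qd d0))) iN.
have deriv_lim : eqX N.-1 (- Ql^`()) (Ql * cbar).
  move=> i iN; have iN' : (i.+1 < N)%N by lia.
  have := newton_lim i.+1 iN'; rewrite !coefN /theta coefXM /= => ->.
  rewrite coefM big_ord_recr /= subnn [(pos_series N c)`_0]coef_poly N0 mulr0 addr0.
  rewrite coefM; apply: eq_bigr => j _; congr (_ * _); have ji := ltn_ord j.
  rewrite !coef_poly ifT; last lia.
  rewrite ifT; last lia.
  by have -> : (i.+1 - j = (i - j).+1)%N by lia.
have limit_eq : eqX N ((Ql \Po psi) * (theta psi * (cbar \Po psi))) (- theta (Ql \Po psi)).
  rewrite theta_comp.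
  have := eqX_shift (theta_coef0 psi) (eqX_comp_l psi0 deriv_lim).
  rewrite prednK // => h.
  have -> : - ((Ql^`() \Po psi) * theta psi) = theta psi * (- Ql^`() \Po psi).
    by rewrite raddfN /=; ring.
  rewrite h comp_polyM; apply/eqX_sub; rewrite (_ : _ - _ = 0) //; ring.
have hD : coef_cvg N (fun d => pos_series N (fun n =>
      d%:R * (poly_moment (ffmul d (p d) (q d)) n - poly_moment (p d) n)))
    (theta psi * (cbar \Po psi)).
  apply: (@coef_cvg_div _ N H _ (fun d => - theta (H d)) _ _ _ _ _ limit_eq hH).
  - by move=> d d0; apply: ffmul_factor0 => //; [exact: pd|exact: qd].
  - by move=> d d0; apply: ffmul_factor_moments => //; [exact: pd|exact: qd].
  - exact: coef_cvgN (coef_cvg_theta hH).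
apply: seq_cvg_eq (hD n nN) => d; rewrite coef_poly nN.
by case: n n0 {nN}.
Qed.

End PowerSumLimit.

End SequenceLimits.

(** * Infinitesimal distributions *)

Section Laws.
Local Open Scope classical_set_scope.
Variable R : realType.

Lemma moment0 (mu : real_law R) : moment mu 0 = 1.
Proof.
rewrite /moment (eq_integral (fun=> 1%E)) => [|x _]; last by rewrite expr0.
rewrite integral_cst // mul1e; exact: (congr1 fine (probability_setT mu)).
Qed.

Lemma moment_dirac1 (nu : real_law R)
    (h : forall A : set (measurableTypeR R), measurable A -> nu A = \d_(1 : R) A) n :
  moment nu n = 1.
Proof.
have -> : moment nu n = fine (\int[\d_(1%R : measurableTypeR R)]_x (x ^+ n)%:E)%E.
  by congr fine; apply: eq_measure_integral => A mA _; exact: h.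
rewrite integral_dirac //; last first.
  by apply/measurable_realfun.measurable_EFinP; apply: measurable_realfun.exprn_measurable.
by rewrite diracT mul1e expr1n.
Qed.

(** The binomial transform is unitriangular, so the translated power sums can be
    recovered from the others one after the other. *)
Lemma shifted_power_sums_cvg (q : nat -> {poly R}) (b c : nat -> R) :
  (forall d, (0 < d)%N -> monic_of_degree d (q d)) ->
  (forall n, (0 < n)%N -> d%:R * (poly_moment (q d) n - 1) @[d --> \oo] --> b n) ->
  (forall n, (0 < n)%N -> b n = \sum_(1 <= k < n.+1) c k *+ 'C(n, k)) ->
  forall n, (0 < n)%N ->
    d%:R * poly_moment (q d \Po ('X + 1%:P)) n @[d --> \oo] --> c n.
Proof.
move=> qd qb bc; elim/ltn_ind => n ih n0.
have cE : c n = b n - \sum_(1 <= k < n) c k *+ 'C(n, k).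
  by rewrite bc // big_nat_recr //= binn mulr1n addrAC subrr add0r.
rewrite cE; apply: (@seq_cvg_pos _ _ (fun d => d%:R * (poly_moment (q d) n - 1) -
  \sum_(1 <= k < n) d%:R * poly_moment (q d \Po ('X + 1%:P)) k * 'C(n, k)%:R)).
  move=> d d0; rewrite mulrBr mulr1 (poly_moment_shift n d0 (qd d d0)).
  rewrite -(big_mkord predT (fun k =>
     d%:R * poly_moment (q d \Po ('X + 1%:P)) k *+ 'C(n, k))).
  rewrite big_ltn // bin0 (poly_moment0 d0 (monic_shift (qd d d0))) mulr1 mulr1n.
  rewrite [d%:R + _]addrC addrK big_nat_recr //= binn mulr1n.
  rewrite [X in _ - X](eq_bigr (fun k =>
     d%:R * poly_moment (q d \Po ('X + 1%:P)) k *+ 'C(n, k))).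
    by rewrite addrAC subrr add0r.
  by move=> k _; rewrite mulr_natr.
apply: cvgB; first exact: qb.
rewrite big_seq.
apply: (@seq_cvg_eq _ _ (fun d => \sum_(k <- index_iota 1 n | k \in index_iota 1 n)
  d%:R * poly_moment (q d \Po ('X + 1%:P)) k * 'C(n, k)%:R)) => [d|].
  exact: big_seq.
apply: seq_cvg_sum => k; rewrite mem_index_iota => /andP[k0 kn].
by rewrite -[c k *+ _]mulr_natr; apply: seq_cvgM; [exact: ih|exact: cvg_cst].
Qed.

End Laws.

Theorem proposition4p10 (R : realType) (p q : nat -> {poly R})
    (mu nu gamma : real_law R) (mu' nu' gamma' : {scalar {poly R}})
    (hp : forall d, (0 < d)%N -> real_rooted d (p d))
    (hq : forall d, (0 < d)%N -> real_rooted d (q d))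
    (hmu : moment_determinate mu) (hnu : moment_determinate nu)
    (hpmu : has_inf_distribution p mu mu')
    (hqnu : has_inf_distribution q nu nu')
    (hgamma : is_inf_free_mul mu mu' nu nu' gamma gamma')
    (hnu1 : forall A : set (measurableTypeR R),
        measurable A -> nu A = \d_(1 : R) A) :
  has_inf_distribution (fun d => ffmul d (p d) (q d)) gamma gamma'.
Proof.
case: hpmu => pd _ pm _ pm'; case: hqnu => qd _ _ _ qm'.
case: hgamma => -[_ [gfin _] gE] g1 g'E.
have e1 := moment_dirac1 hnu1.
have gm n : moment gamma n = moment mu n.
  exact: (convolution_moment (moment0 mu) (moment0 gamma) e1 gE n).
have nu_cvg n : (0 < n)%N ->
    (d%:R * (poly_moment (q d) n - 1) @[d --> \oo] --> (nu' 'X^n : R))%classic.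
  by move=> n0; have := qm' n n0; rewrite e1.
have qc := shifted_power_sums_cvg qd nu_cvg
  (inf_cumulant_binomial (fun n => nu' 'X^n) e1).
(* The truncation order n + 1 is the least that sees the coefficient of X^n. *)
have main n : (0 < n)%N -> (d%:R * (poly_moment (ffmul d (p d) (q d)) n -
    poly_moment (p d) n) @[d --> \oo] --> (gamma' 'X^n - mu' 'X^n : R))%classic.
  move=> n0; have nN : (0 < n < n.+1)%N by rewrite n0 ltnSn.
  have := ffmul_moment_difference pd qd pm qc (ltn0Sn n) nN.
  rewrite (convolution_inf_moment (moment0 mu) e1 gE g'E nN).
  exact.
split=> [d d0|//|n|//|n n0].
- by apply: monic_ffmul => //; [exact: pd|exact: qd].
- rewrite gm; case: (posnP n) => [->|n0].
    rewrite moment0; apply: (@seq_cvg_pos _ _ (fun=> 1)); last exact: cvg_cst.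
    move=> d d0; apply: (poly_moment0 d0).
    by apply: monic_ffmul => //; [exact: pd|exact: qd].
  rewrite -[moment mu n]addr0 -[X in (_ --> _ + X)%classic](mul0r (gamma' 'X^n - mu' 'X^n)).
  apply: (@seq_cvg_pos _ _ (fun d => poly_moment (p d) n + d%:R^-1 *
      (d%:R * (poly_moment (ffmul d (p d) (q d)) n - poly_moment (p d) n)))).
    move=> d d0; rewrite mulKf ?pnatr_eq0 -?lt0n //.
    by rewrite addrC subrK.
  apply: cvgD; first exact: pm.
  by apply: seq_cvgM (main n n0); apply: cvg_invn.
- rewrite gm -[gamma' _](subrK (mu' 'X^n)).
  apply: seq_cvg_eq (cvgD (main n n0) (pm' n n0)) => d /=.
  by rewrite -mulrDr subrKA.
Qed.
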